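(* Let $F=F(A)$ be a free group with free basis $A=\{a_1,\dots,a_k\}$ of rank $k\ge 2$. Let $\phi:F\to Aut(X)$ be a free simplicial action without inversions of $F$ on a simplicial tree $X$. Then the following hold: (1) The generic stretching factor $\lambda=\lambda(\phi)$ is a rational number $\ge 1$ with $$2k\lambda\in\mathbb Z\left[\frac{1}{2k-1}\right].$$ (2) The number $\lambda(\phi)$ is algorithmically computable in terms of $\phi$, provided $X$ is the universal cover of a finite connected graph and $\phi$ is given by an isomorphism between $F$ and the fundamental group of that graph. That is, there is an algorithm which, given a finite connected graph $\Gamma$ with a base vertex $p$ and an explicit isomorphism $F\to\pi_1(\Gamma,p)$, computes $\lambda(\phi)$ for the corresponding action $\phi$ of $F$ on the universal cover $X$ of $\Gamma$.
   Context: A simplicial tree is given the path metric $d$ in which every edge has length $1$. The boundary $\partial F$ is the set of semi-infinite freely reduced words over $A^{\pm1}$; $\omega_n\in F$ is the initial segment of length $n$ of $\omega\in\partial F$; $\mu_A$ is the Borel probability measure on $\partial F$ giving the set of all $\omega$ beginning with a freely reduced word $v\neq 1$ the mass $\frac{1}{2k(2k-1)^{|v|-1}}$. For $x\in X$ and $w\in F$ put $|w|_x:=d(x,\phi(w)x)$. The generic stretching factor $\lambda(\phi)=\lambda_A(\phi)$ is the constant such that $\lim_{n\to\infty}\frac{|\omega_n|_x}{n}=\lambda(\phi)$ for $\mu_A$-a.e. $\omega\in\partial F$; it exists and does not depend on $x\in X$. *)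

(* Defs.v *)
From HB Require Import structures.
From mathcomp Require Import all_boot all_order all_algebra.
From mathcomp Require Import all_classical all_reals all_analysis.
Import Order.TTheory GRing.Theory Num.Theory numFieldNormedType.Exports.

Set Implicit Arguments.
Unset Strict Implicit.
Unset Printing Implicit Defensive.

Local Open Scope classical_set_scope.
Local Open Scope ring_scope.

(* Words over an alphabet [T] with formal inverses given by the involution
   [inv].  They serve both for words over A^{+-1} and for edge paths. *)

Definition reduced (T : eqType) (inv : T -> T) (s : seq T) : bool :=
  sorted (fun e f => f != inv e) s.

(* The unique freely reduced word obtained by cancelling factors e e^-1. *)
Definition reduce (T : eqType) (inv : T -> T) (s : seq T) : seq T :=
  foldr (fun e r => if r is f :: r' then
                      if f == inv e then r' else e :: r
                    else [:: e]) [::] s.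

(* (i, false) is the letter a_i and (i, true) is its inverse. *)
Notation letter k := ('I_k * bool)%type (only parsing).

Definition linv (k : nat) (l : letter k) : letter k := (l.1, ~~ l.2).

Definition letter_val (F : groupType) (k : nat) (a : 'I_k -> F)
    (l : letter k) : F :=
  (if l.2 then (a l.1)^-1 else a l.1)%g.

Definition word_val (F : groupType) (k : nat) (a : 'I_k -> F)
    (s : seq (letter k)) : F :=
  (\prod_(l <- s) letter_val a l)%g.

Definition free_basis (F : groupType) (k : nat) (a : 'I_k -> F) : Prop :=
  forall g : F, exists! s : seq (letter k),
    reduced (@linv k) s /\ word_val a s = g.

(* The hypothesis on [k] is a parameter of the type only because measurable
   types are required to be inhabited. *)
Record boundary (k : nat) (hk : (1 < k)%N) := Boundary {
  bword :> nat -> letter k;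
  bwordP : forall n, bword n.+1 != linv (bword n) }.

Lemma boundary_point_subproof (k : nat) (hk : (1 < k)%N) :
  forall n : nat, (Ordinal (ltnW hk), false) != linv (Ordinal (ltnW hk), false).
Proof. by []. Qed.

HB.instance Definition _ k hk := gen_eqMixin (@boundary k hk).
HB.instance Definition _ k hk := gen_choiceMixin (@boundary k hk).
HB.instance Definition _ k hk := isPointed.Build (@boundary k hk)
  (@Boundary k hk (fun=> (Ordinal (ltnW hk), false))
     (boundary_point_subproof hk)).

Definition initial_segment (k : nat) (hk : (1 < k)%N) (w : boundary hk)
    (n : nat) : seq (letter k) :=
  mkseq w n.

Definition cylinder (k : nat) (hk : (1 < k)%N) (v : seq (letter k)) :
    set (boundary hk) :=
  [set w | initial_segment w (size v) = v].
Arguments cylinder {k} hk v.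

Definition cylinders (k : nat) (hk : (1 < k)%N) : set (set (boundary hk)) :=
  [set cylinder hk v | v in [set: seq (letter k)]].
Arguments cylinders {k} hk.

(* The cylinders form a countable base of the topology of the boundary, hence
   they generate its Borel sigma-algebra. *)
Notation borel_boundary hk := (g_sigma_algebraType (cylinders hk)).

(* This determines the probability measure [mu]. *)
Definition uniform_measure (R : realType) (k : nat) (hk : (1 < k)%N)
    (mu : probability (borel_boundary hk) R) : Prop :=
  forall v : seq (letter k), v != [::] -> reduced (@linv k) v ->
    mu (cylinder hk v) =
      ((2 * k%:R * (2 * k%:R - 1) ^+ (size v).-1)^-1 : R)%:E.

(* Graphs in the sense of Serre: [edge] is the type of oriented edges; loops
   and multiple edges are allowed. *)
Record sgraph := SGraph {
  vert : eqType;
  edge : eqType;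
  orig : edge -> vert;
  einv : edge -> edge;
  einvK : involutive einv;
  einv_neq : forall e, einv e != e }.

Definition term (X : sgraph) (e : edge X) : vert X := orig (einv e).

Fixpoint edge_path (X : sgraph) (u : vert X) (s : seq (edge X))
    (v : vert X) : bool :=
  if s is e :: s' then (orig e == u) && edge_path (term e) s' v else u == v.

Definition connected_graph (X : sgraph) : Prop :=
  forall u v : vert X, exists s, edge_path u s v.

Definition simplicial_tree (X : sgraph) : Prop :=
  [/\ inhabited (vert X), connected_graph X &
      forall (u : vert X) (s : seq (edge X)),
        edge_path u s u -> reduced (@einv X) s -> s = [::]].

(* Points of the geometric realization; [OnEdge e t] is the point of [e] at
   distance [t] from [orig e].  A point may have several names, which are then
   at distance 0 from each other. *)
Inductive point (R : realType) (X : sgraph) : Type :=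
| Vertex of vert X
| OnEdge (e : edge X) (t : R) of 0 <= t <= 1.
Arguments Vertex {R X}.
Arguments OnEdge {R X}.

Definition vdist (R : realType) (X : sgraph) (u v : vert X) : R :=
  inf [set l | exists2 s, edge_path u s v & l = (size s)%:R].

Definition pvdist (R : realType) (X : sgraph) (x : point R X)
    (v : vert X) : R :=
  match x with
  | Vertex u => vdist R u v
  | OnEdge e t _ =>
      Num.min (t + vdist R (orig e) v) (1 - t + vdist R (term e) v)
  end.

(* The path metric, on a tree, for edges of length 1. *)
Definition pdist (R : realType) (X : sgraph) (x y : point R X) : R :=
  match y with
  | Vertex v => pvdist x v
  | OnEdge f s _ =>
      let through_ends :=
        Num.min (pvdist x (orig f) + s) (pvdist x (term f) + (1 - s)) in
      match x with
      | Vertex _ => through_ends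
      | OnEdge e t _ =>
          if e == f then `|t - s|
          else if e == einv f then `|t - (1 - s)|
          else through_ends
      end
  end.

(* Homomorphisms from [F] to the group of automorphisms of [X]. *)
Record action (F : groupType) (X : sgraph) := Action {
  actV : F -> vert X -> vert X;
  actE : F -> edge X -> edge X;
  actV1 : forall v, actV 1%g v = v;
  actVM : forall g h v, actV (g * h)%g v = actV g (actV h v);
  actE1 : forall e, actE 1%g e = e;
  actEM : forall g h e, actE (g * h)%g e = actE g (actE h e);
  act_orig : forall g e, orig (actE g e) = actV g (orig e);
  act_einv : forall g e, einv (actE g e) = actE g (einv e) }.

Definition free_action (F : groupType) (X : sgraph) (phi : action F X) : Prop :=
  forall g v, actV phi g v = v -> g = 1%g.

Definition without_inversions (F : groupType) (X : sgraph)
    (phi : action F X) : Prop :=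
  forall g e, actE phi g e != einv e.

Definition actP (R : realType) (F : groupType) (X : sgraph)
    (phi : action F X) (g : F) (x : point R X) : point R X :=
  match x with
  | Vertex v => Vertex (actV phi g v)
  | OnEdge e t ht => OnEdge (actE phi g e) t ht
  end.

(* |g|_x *)
Definition displacement (R : realType) (F : groupType) (X : sgraph)
    (phi : action F X) (x : point R X) (g : F) : R :=
  pdist x (actP phi g x).

Definition is_stretching_factor (R : realType) (F : groupType) (k : nat)
    (hk : (1 < k)%N) (a : 'I_k -> F) (mu : probability (borel_boundary hk) R)
    (X : sgraph) (phi : action F X) (lam : R) : Prop :=
  forall x : point R X,
    {ae mu, forall w : borel_boundary hk,
      (fun n : nat => displacement phi x (word_val a (initial_segment w n))
                        / n%:R) @ \oo --> lam}.

(* The real number satisfying [is_stretching_factor]; a dummy value if there is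
   no such number. *)
Definition stretching_factor (R : realType) (F : groupType) (k : nat)
    (hk : (1 < k)%N) (a : 'I_k -> F) (mu : probability (borel_boundary hk) R)
    (X : sgraph) (phi : action F X) : R :=
  xget 0 [set lam | is_stretching_factor a mu phi lam].

(* Z[z], as a subset of the ring containing [z] *)
Definition int_adjoin (R : realType) (z : R) : set R :=
  [set y | exists P : {poly int}, y = (map_poly intr P).[z]].

(* The finite graph with vertex set 'I_n and geometric edges 'I_m, the [i]-th
   of which goes from [(tnth ends i).1] to [(tnth ends i).2]; [(i, true)] is
   that edge with the orientation reversed. *)
Section FiniteGraph.
Variables (n m : nat) (ends : m.-tuple ('I_n * 'I_n)).

Definition fg_orig (e : 'I_m * bool) : 'I_n :=
  if e.2 then (tnth ends e.1).2 else (tnth ends e.1).1.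

Definition fg_inv (e : 'I_m * bool) : 'I_m * bool := (e.1, ~~ e.2).

Lemma fg_invK : involutive fg_inv.
Proof. by case=> i b; rewrite /fg_inv /= negbK. Qed.

Lemma fg_inv_neq e : fg_inv e != e.
Proof. by case: e => i []; rewrite xpair_eqE andbF. Qed.

Definition finite_graph : sgraph :=
  @SGraph 'I_n ('I_m * bool)%type fg_orig fg_inv fg_invK fg_inv_neq.

End FiniteGraph.

Definition homotopic (G : sgraph) (s t : seq (edge G)) : Prop :=
  reduce (@einv G) s = reduce (@einv G) t.

(* [theta], which picks a closed path in each class, induces an isomorphism
   from [F] onto the fundamental group of homotopy classes of closed paths
   at [p]. *)
Definition pi1_isomorphism (F : groupType) (G : sgraph) (p : vert G)
    (theta : F -> seq (edge G)) : Prop :=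
  [/\ forall g, edge_path p (theta g) p,
      forall g h, homotopic (theta (g * h)%g) (theta g ++ theta h),
      forall g h, homotopic (theta g) (theta h) -> g = h &
      forall s, edge_path p s p -> exists g, homotopic (theta g) s].

Record covering (X G : sgraph) := Covering {
  covV : vert X -> vert G;
  covE : edge X -> edge G;
  cov_orig : forall e, orig (covE e) = covV (orig e);
  cov_einv : forall e, einv (covE e) = covE (einv e);
  cov_star : forall (v : vert X) (e' : edge G), orig e' = covV v ->
    exists! e : edge X, orig e = v /\ covE e = e' }.

(* [phi] is the action by deck transformations in which [g] takes the base
   point [x0] to the end of the lift at [x0] of the closed path [theta g]. *)
Definition deck_action (F : groupType) (X G : sgraph) (c : covering X G)
    (x0 : vert X) (theta : F -> seq (edge G)) (phi : action F X) : Prop :=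
  [/\ forall g v, covV c (actV phi g v) = covV c v,
      forall g e, covE c (actE phi g e) = covE c e &
      forall g, exists2 s, edge_path x0 s (actV phi g x0) &
                           map (covE c) s = theta g].

(* Kleene's partial recursive functions.  Arities are left implicit: [rSucc]
   and [rProj] read missing arguments as 0, [rPrec] diverges without
   arguments. *)
Inductive recfun : Type :=
| rZero
| rSucc
| rProj of nat
| rComp of recfun & seq recfun
| rPrec of recfun & recfun
| rMu of recfun.

(* [rec_eval f xs y]: the computation of [f] on [xs] halts with result [y]. *)
Inductive rec_eval : recfun -> seq nat -> nat -> Prop :=
| eval_zero xs : rec_eval rZero xs 0
| eval_succ xs : rec_eval rSucc xs (head 0%N xs).+1
| eval_proj i xs : rec_eval (rProj i) xs (nth 0%N xs i)
| eval_comp f gs xs ys y :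
    rec_evals gs xs ys -> rec_eval f ys y -> rec_eval (rComp f gs) xs y
| eval_prec0 f g xs y :
    rec_eval f xs y -> rec_eval (rPrec f g) (0%N :: xs) y
| eval_precS f g n xs r y :
    rec_eval (rPrec f g) (n :: xs) r -> rec_eval g [:: n, r & xs] y ->
    rec_eval (rPrec f g) (n.+1 :: xs) y
| eval_mu f xs n (ys : nat -> nat) :
    rec_eval f (n :: xs) 0 ->
    (forall i, (i < n)%N -> rec_eval f (i :: xs) (ys i).+1) ->
    rec_eval (rMu f) xs n
with rec_evals : seq recfun -> seq nat -> seq nat -> Prop :=
| evals_nil xs : rec_evals [::] xs [::]
| evals_cons g gs xs y ys :
    rec_eval g xs y -> rec_evals gs xs ys -> rec_evals (g :: gs) xs (y :: ys).

(* The numerical code of a finite graph, a base vertex, and the list of the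
   closed paths to which an isomorphism F -> pi_1 sends a_1, ..., a_k. *)
Definition input_code (n m k : nat) (ends : m.-tuple ('I_n * 'I_n)) (p : 'I_n)
    (loops : k.-tuple (seq ('I_m * bool))) : nat :=
  pickle (n,
          [seq (nat_of_ord e.1, nat_of_ord e.2) | e <- ends],
          nat_of_ord p,
          [seq [seq (nat_of_ord e.1, nat_of_bool e.2) | e <- s : seq _]
              | s <- loops]).

(* Main.v *)
Require Import Defs.
From HB Require Import structures.
From mathcomp Require Import all_boot all_order all_algebra.
From mathcomp Require Import all_classical all_reals all_analysis.
From mathcomp Require Import zify ring lra.
Import Order.TTheory GRing.Theory Num.Theory numFieldNormedType.Exports.

(* Put K = 2k - 1 and l(w) = d(x, wx) for a vertex x, and let E_n be the mean of
   l over the reduced words of length n.  Cancellation in reduced products is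
   bounded, so for large N the length of a product of blocks of length N is
   determined by pairs of neighbours:
     l(u_1 ... u_n) = sum_i l(u_i u_(i+1)) - sum_(1 < i < n) l(u_i).
   On average this gives E_(nN) = (n - 1) E_(2N) - (n - 2) E_N, and the stretching
   factor is (E_(2N) - E_N) / N.  Choosing N to be a power of K shows that 2k
   times this number lies in Z[1/K].  The block formula only requires finitely
   many inequalities between lengths of words of length at most 2N, so that an
   algorithm can search for a suitable N.

   Almost sure convergence: revealing the letters of a random word one at a time
   changes the conditional mean of l by a bounded amount, so the variance of l on
   words of length n is O(n); Chebyshev's inequality and Borel-Cantelli apply
   along n = N j^4, and l is Lipschitz.

   Properness of l and the bound 1 <= lambda come from counting.  Choose x
   minimizing the sum of the d(x, a_i x).  Then the quotient of the hull of the
   orbit has no vertex of degree 1, and its first Betti number is at most k, so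
   its degrees are at most 2k and there are O(K^r) elements with l = r, while
   there are 2k K^(n-1) reduced words of length n. *)

(** The geometry of the tree enters the block formula only through the four-point inequality. Of the
    three ways to pair four points, the two larger sums agree, so a strict inequality for triples of
    neighbouring blocks propagates to an exact identity for any number of blocks. Exactness is the
    point: an identity up to bounded error would give a limit, but no arithmetic information about
    it. Every N that satisfies the block inequalities yields the same value, because the almost sure
    limit is unique. Hence the arithmetic part may choose N to be a power of K, so that division by
    N stays inside Z[1/K], while the algorithm may stop at the first N that passes its test; no
    effective bound on cancellation is required, only that some N exists. *)

Set Implicit Arguments.
Unset Strict Implicit.
Unset Printing Implicit Defensive.

(** * Reduced words *)

Section Reduce.
Variables (T : eqType) (inv : T -> T).
Hypothesis invK : involutive inv.

Definition winv (s : seq T) := rev (map inv s).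

Definition push (e : T) (r : seq T) : seq T :=
  if r is f :: r' then if f == inv e then r' else e :: r else [:: e].

Lemma reduceE s : reduce inv s = foldr push [::] s.
Proof. by elim: s => //= e s ->. Qed.

Lemma reduced_cons e s :
  reduced inv (e :: s) = (if s is f :: _ then f != inv e else true) && reduced inv s.
Proof. by rewrite /reduced; case: s. Qed.

Lemma reduced_behead e s : reduced inv (e :: s) -> reduced inv s.
Proof. by rewrite reduced_cons => /andP[]. Qed.

Lemma push_reduced e r : reduced inv r -> reduced inv (push e r).
Proof.
case: r => //= f r rr; case: ifP => [_|/negbT ne]; first exact: reduced_behead rr.
by rewrite reduced_cons ne.
Qed.

Lemma foldr_push_reduced r s : reduced inv r -> reduced inv (foldr push r s).
Proof. by move=> rr; elim: s => //= e s; apply: push_reduced. Qed.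

Lemma reduce_reduced s : reduced inv (reduce inv s).
Proof. by rewrite reduceE foldr_push_reduced. Qed.

Lemma push_id e r : reduced inv (e :: r) -> push e r = e :: r.
Proof. by rewrite reduced_cons; case: r => //= f r /andP[/negbTE ->]. Qed.

Lemma reduce_id s : reduced inv s -> reduce inv s = s.
Proof.
rewrite reduceE; elim: s => //= e s IHs rs.
by rewrite IHs ?push_id //; apply: reduced_behead rs.
Qed.

(** Van der Waerden's trick: letters act on reduced words by permutations, inverse letters by
    inverse permutations. This replaces a confluence argument for reduction. *)
Lemma pushK e r : reduced inv r -> push e (push (inv e) r) = r.
Proof.
case: r => [|f r] rr /=; first by rewrite eqxx.
rewrite invK; case: eqP rr => [->|_ rr]; first exact: push_id.
by rewrite /= eqxx.
Qed.

Lemma foldr_push_reduce r s : reduced inv r ->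
  foldr push r s = foldr push r (reduce inv s).
Proof.
move=> rr; rewrite reduceE; elim: s => //= e s ->.
case E: (foldr push [::] s) => [|f s'] //=.
case: eqP => [->|//]; rewrite /= pushK //.
exact: foldr_push_reduced.
Qed.

Lemma reduce_cat s t :
  reduce inv (s ++ t) = reduce inv (reduce inv s ++ reduce inv t).
Proof.
rewrite !reduceE !foldr_cat -!reduceE (reduce_id (reduce_reduced t)).
by rewrite foldr_push_reduce ?reduce_reduced.
Qed.

Lemma reduce_catl s t : reduce inv (reduce inv s ++ t) = reduce inv (s ++ t).
Proof. by rewrite reduce_cat (reduce_id (reduce_reduced s)) -reduce_cat. Qed.

Lemma reduce_catr s t : reduce inv (s ++ reduce inv t) = reduce inv (s ++ t).
Proof. by rewrite reduce_cat (reduce_id (reduce_reduced t)) -reduce_cat. Qed.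

Lemma winvK : involutive winv.
Proof. by move=> s; rewrite /winv map_rev revK -map_comp map_id_in // => x _ /=. Qed.

Lemma winv_cat s t : winv (s ++ t) = winv t ++ winv s.
Proof. by rewrite /winv map_cat rev_cat. Qed.

Lemma winv_cons e s : winv (e :: s) = rcons (winv s) (inv e).
Proof. by rewrite /winv /= rev_cons. Qed.

Lemma size_winv s : size (winv s) = size s.
Proof. by rewrite /winv size_rev size_map. Qed.

Lemma winv_drop n s : winv (drop n s) = take (size s - n) (winv s).
Proof.
rewrite /winv take_rev size_map -map_drop.
case: (leqP n (size s)) => h; first by rewrite subKn.
by rewrite (_ : size s - n = 0) ?subn0 ?drop_oversize ?(ltnW h) //; lia.
Qed.

Lemma reduced_winv s : reduced inv (winv s) = reduced inv s.
Proof.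
rewrite /reduced /winv rev_sorted sorted_map.
case: s => //= x s; apply: eq_path => {}x y /=.
by rewrite invK eq_sym.
Qed.

Lemma reduce_catV s : reduce inv (s ++ winv s) = [::].
Proof.
elim: s => //= e s IHs.
rewrite winv_cons -cats1 catA -[LHS]/(reduce inv ([:: e] ++ _)).
by rewrite -reduce_catr -(reduce_catl (s ++ _)) IHs /= eqxx.
Qed.

Lemma reduce_Vcat s : reduce inv (winv s ++ s) = [::].
Proof. by rewrite -{2}[s]winvK reduce_catV. Qed.

Lemma reduce_winv s : reduce inv (winv s) = winv (reduce inv s).
Proof.
rewrite -[RHS]reduce_id ?reduced_winv ?reduce_reduced //.
set r := reduce inv s.
rewrite -[winv s in LHS]cats0 -(reduce_catV r) reduce_catr catA -reduce_catl.
by rewrite reduce_catr reduce_Vcat.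
Qed.

Lemma reduce_eq_catV s t : reduce inv s = reduce inv t <-> reduce inv (s ++ winv t) = [::].
Proof.
split=> [st|st]; first by rewrite -reduce_catl st reduce_catl reduce_catV.
by rewrite -[s in LHS]cats0 -(reduce_Vcat t) reduce_catr catA -reduce_catl st.
Qed.

Lemma size_reduce s : size (reduce inv s) <= size s.
Proof.
rewrite reduceE; elim: s => //= e s; case: (foldr _ _ _) => //= f r.
by case: ifP => _ /=; lia.
Qed.

Lemma mem_reduce s : {subset reduce inv s <= s}.
Proof.
rewrite reduceE; elim: s => //= e s; case: (foldr _ _ _) => [|f r] //= IH x.
  by rewrite !inE => ->.
rewrite inE; case: ifP => _ xr; first by rewrite IH ?orbT // inE xr orbT.
by move: xr; rewrite inE => /orP[->//|/IH ->]; rewrite orbT.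
Qed.

Lemma reduced_cat s t : reduced inv (s ++ t) -> reduced inv s /\ reduced inv t.
Proof.
by rewrite /reduced; case: s => [|x s] /=; rewrite ?cat_path => // /andP[-> /path_sorted].
Qed.

Lemma reduced_rcons_cat s x t : reduced inv (rcons s x ++ t) =
  [&& reduced inv (rcons s x), (if t is y :: _ then y != inv x else true) &
      reduced inv t].
Proof.
rewrite /reduced; case: t => [|y t]; first by rewrite cats0 andbT.
by case: s => [|z s] //=; rewrite cat_path last_rcons.
Qed.

End Reduce.

Lemma reduce_map (T U : eqType) (invT : T -> T) (invU : U -> U) (f : T -> U) s :
  injective f -> (forall x, f (invT x) = invU (f x)) ->
  reduce invU (map f s) = map f (reduce invT s).
Proof.
move=> finj fV; rewrite !reduceE; elim: s => //= e s ->.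
by case: (foldr _ _ s) => //= x r; rewrite -fV (inj_eq finj); case: eqP.
Qed.

Arguments reduce : simpl never.
Arguments reduced : simpl never.
Arguments winv : simpl never.

(** * Trees *)

(** The longest common prefix. On geodesics issuing from one vertex of a tree it is the Gromov
    product, and [lcp_ultra] is then the ultrametric form of 0-hyperbolicity. *)
Fixpoint lcp (T : eqType) (s t : seq T) : nat :=
  match s, t with
  | x :: s', y :: t' => if x == y then (lcp s' t').+1 else 0
  | _, _ => 0
  end.

Lemma lcp_ultra (T : eqType) (s t u : seq T) :
  minn (lcp s t) (lcp t u) <= lcp s u.
Proof.
elim: s t u => [|x s IHs] [|y t] [|z u] //=; try lia.
case: (eqVneq x y) => [<-|]; last by rewrite min0n.
by case: (x == z); rewrite ?minn0 // minnSS ltnS.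
Qed.

(** Exactly the common prefix cancels, once from each factor. *)
Lemma size_reduce_lcp (T : eqType) (inv : T -> T) (s t : seq T) :
  involutive inv -> reduced inv s -> reduced inv t ->
  size (reduce inv (winv inv s ++ t)) + (lcp s t).*2 = size s + size t.
Proof.
move=> invK; elim: s t => [|x s IHs] [|y t] //= rs rt.
- by rewrite reduce_id // addn0.
- by rewrite cats0 reduce_id ?reduced_winv // size_winv !addn0.
case: eqP => [xy|/eqP xy].
  rewrite winv_cons -xy -cats1 -catA.
  have -> : reduce inv (winv inv s ++ [:: inv x] ++ x :: t) = reduce inv (winv inv s ++ t).
    rewrite -(reduce_catr invK (winv inv s) (_ ++ _)) -(reduce_catr invK _ t).
    rewrite -(reduce_catl invK) -[x :: t]/([:: x] ++ t) catA.
    rewrite -(reduce_catl invK (_ ++ _)) -[[:: inv x]]/(winv inv [:: x]).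
    by rewrite (reduce_Vcat invK) (reduce_catl invK).
  by have := IHs t (reduced_behead rs) (reduced_behead rt); lia.
rewrite reduce_id; first by rewrite size_cat size_winv /= doubleE; lia.
rewrite winv_cons reduced_rcons_cat rt -winv_cons reduced_winv // rs invK.
by rewrite eq_sym xy.
Qed.

Section Paths.
Variable X : sgraph.
Implicit Types (u v w : vert X) (s t : seq (edge X)).

Lemma edge_path_cat u v w s t :
  edge_path u s w -> edge_path u (s ++ t) v = edge_path w t v.
Proof.
elim: s u => [u /eqP ->//|e s IHs u] /= /andP[-> ps] /=; exact: IHs.
Qed.

Lemma edge_path_split u v s t : edge_path u (s ++ t) v ->
  exists2 w, edge_path u s w & edge_path w t v.
Proof.
elim: s u => [u p|e s IHs u] /=; first by exists u.
by case/andP => -> /IHs[w ps pt]; exists w.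
Qed.

Lemma edge_path_winv u v s :
  edge_path u s v -> edge_path v (winv (@einv X) s) u.
Proof.
elim: s u => [u /eqP ->|e s IHs u]; first exact: eqxx.
case/andP => /eqP <- /IHs ps; rewrite winv_cons -cats1 (edge_path_cat _ _ ps) /=.
by rewrite /term einvK !eqxx.
Qed.

Lemma edge_path_reduce u v s :
  edge_path u s v -> edge_path u (reduce (@einv X) s) v.
Proof.
rewrite reduceE; elim: s u => //= e s IHs u /andP[eu /IHs].
case: (foldr _ _ _) => [|f r] /=; first by rewrite eu.
case/andP=> fe pr; case: eqP => [E|_] /=; last by rewrite eu fe.
by move: pr; rewrite E /term einvK (eqP eu).
Qed.

Lemma edge_path_target u v w s : edge_path u s v -> edge_path u s w -> v = w.
Proof. by elim: s u => [u /eqP <- /eqP <-//|e s IHs u] /= /andP[_ /IHs h] /andP[_ /h]. Qed.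

Hypothesis hX : simplicial_tree X.

Lemma reduced_path_uniq u v s t :
  edge_path u s v -> edge_path u t v ->
  reduced (@einv X) s -> reduced (@einv X) t -> s = t.
Proof.
move=> ps pt rs rt; case: hX => _ _ noloop.
rewrite -(reduce_id rs) -(reduce_id rt).
apply/(reduce_eq_catV (@einvK X)); apply: (noloop u).
  by apply: edge_path_reduce; rewrite (edge_path_cat _ _ ps) edge_path_winv.
exact: reduce_reduced.
Qed.

Lemma geod_exists u v :
  exists s, edge_path u s v && reduced (@einv X) s.
Proof.
case: hX => _ /(_ u v)[s ps] _; exists (reduce (@einv X) s).
by rewrite edge_path_reduce // reduce_reduced.
Qed.

Definition geod u v := projT1 (cid (geod_exists u v)).

Lemma geod_path u v : edge_path u (geod u v) v.
Proof. by rewrite /geod; case: cid => s /= /andP[]. Qed.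

Lemma geod_reduced u v : reduced (@einv X) (geod u v).
Proof. by rewrite /geod; case: cid => s /= /andP[]. Qed.

Lemma reduce_geod u v s : edge_path u s v -> reduce (@einv X) s = geod u v.
Proof.
move=> ps; apply: (reduced_path_uniq (edge_path_reduce ps) (geod_path u v)).
  exact: reduce_reduced.
exact: geod_reduced.
Qed.

Lemma reduced_geod u v s :
  edge_path u s v -> reduced (@einv X) s -> s = geod u v.
Proof. by move=> ps rs; rewrite -(reduce_geod ps) reduce_id. Qed.

Definition dist u v : nat := size (geod u v).

Lemma dist_le u v s : edge_path u s v -> dist u v <= size s.
Proof. by move/reduce_geod=> h; rewrite /dist -h size_reduce. Qed.

Lemma distvv u : dist u u = 0.
Proof. by rewrite /dist -(@reduce_geod u u [::] (eqxx u)). Qed.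

Lemma geodC u v : geod v u = winv (@einv X) (geod u v).
Proof.
symmetry; apply: reduced_geod; first exact/edge_path_winv/geod_path.
by rewrite (reduced_winv (@einvK X)) geod_reduced.
Qed.

Lemma distC u v : dist u v = dist v u.
Proof. by rewrite /dist geodC size_winv. Qed.

Lemma dist_triangle v u w : dist u w <= dist u v + dist v w.
Proof.
rewrite -size_cat; apply: dist_le.
by rewrite (edge_path_cat _ _ (geod_path u v)) geod_path.
Qed.

Lemma dist_lcp w u v :
  dist u v + (lcp (geod w u) (geod w v)).*2 = dist w u + dist w v.
Proof.
rewrite /dist -(size_reduce_lcp (@einvK X)) ?geod_reduced //; congr (size _ + _).
symmetry; apply: reduce_geod.
by rewrite (edge_path_cat _ _ (edge_path_winv (geod_path w u))) geod_path.
Qed.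

Lemma dist_4pt x y z w :
  dist x z + dist y w <= maxn (dist x y + dist z w) (dist x w + dist y z).
Proof.
have := lcp_ultra (geod w x) (geod w y) (geod w z).
have := dist_lcp w x y; have := dist_lcp w y z; have := dist_lcp w x z.
by rewrite !(distC w) -!muln2; lia.
Qed.

Lemma vdist_dist (R : realType) u v : vdist R u v = (dist u v)%:R%R.
Proof.
rewrite /vdist; set A := [set _ | _]%classic.
have Ad : A (dist u v)%:R%R by exists (geod u v); rewrite ?geod_path.
have lbA : lbound A (dist u v)%:R%R.
  by move=> _ [s ps ->]; rewrite ler_nat dist_le.
apply/eqP; rewrite eq_le lb_le_inf //; last by exists (dist u v)%:R%R.
by rewrite andbT; apply: ge_inf => //; exists (dist u v)%:R%R.
Qed.

End Paths.

(** * Length functions on free groups *)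

Lemma linvK k : involutive (@linv k).
Proof. by case=> i b; rewrite /linv negbK. Qed.

(** The abstract form of w |-> d(x, wx), on words rather than group elements so that it also covers
    what a program computes. [wl_4pt] is 0-hyperbolicity of the pseudometric |u^-1 v|. *)
Record length_fun (k : nat) (wl : seq (letter k) -> nat) : Prop := LengthFun {
  wl_reduce : forall s, wl (reduce (@linv k) s) = wl s;
  wl_nil : wl [::] = 0;
  wl_winv : forall s, wl (winv (@linv k) s) = wl s;
  wl_cat : forall s t, wl (s ++ t) <= wl s + wl t;
  wl_4pt : forall x y z w,
    let d u v := wl (winv (@linv k) u ++ v) in
    d x z + d y w <= maxn (d x y + d z w) (d x w + d y z) }.

Definition proper_length (k : nat) (wl : seq (letter k) -> nat) : Prop :=
  forall r, exists n, forall s, reduced (@linv k) s -> wl s <= r -> size s <= n.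

Section LengthFun.
Variables (k : nat) (wl : seq (letter k) -> nat).
Hypothesis wlP : length_fun wl.
Implicit Types s t u v w : seq (letter k).
Local Notation red := (reduced (@linv k)).
Local Notation wv := (winv (@linv k)).

Definition letter_bound := \max_(l : letter k) wl [:: l].

Lemma letter_boundP l : wl [:: l] <= letter_bound.
Proof. exact: leq_bigmax. Qed.

Lemma wl_size s : wl s <= letter_bound * size s.
Proof.
elim: s => [|l s IHs]; first by rewrite wl_nil.
rewrite /= mulnS (leq_trans (wl_cat wlP [:: l] s)) // leq_add //.
exact: letter_boundP.
Qed.

Lemma wl_eq s t : reduce (@linv k) s = reduce (@linv k) t -> wl s = wl t.
Proof. by move=> st; rewrite -(wl_reduce wlP) st wl_reduce. Qed.

Let d u v := wl (wv u ++ v).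

Let dC u v : d u v = d v u.
Proof. by rewrite /d -(wl_winv wlP) winv_cat winvK //; apply: linvK. Qed.

Let d0 u : d u [::] = wl u.
Proof. by rewrite /d cats0 wl_winv. Qed.

Let d_triangle v u w : d u w <= d u v + d v w.
Proof.
rewrite /d (@wl_eq (wv u ++ w) ((wv u ++ v) ++ (wv v ++ w))) ?wl_cat //.
rewrite catA -(catA _ v) -(reduce_catl (@linvK k) (_ ++ _) w).
rewrite -[in RHS](reduce_catr (@linvK k) (wv u)).
by rewrite reduce_catV ?cats0 ?reduce_catl //; apply: linvK.
Qed.

Let dV u v : d (wv u) v = wl (u ++ v).
Proof. by rewrite /d winvK //; apply: linvK. Qed.

Let d_4pt x y z w : d x z + d y w <= maxn (d x y + d z w) (d x w + d y z).
Proof. exact: wl_4pt. Qed.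

(** Here c/2 is a height above the origin. If [x] follows [z] up to height c/2 and [x'] leaves it
    earlier, then [x] and [x'] part below c/2, so |x| - c/2 is less than their distance. *)
Let branch_close x x' z c b :
  c + d x z <= wl x + wl z -> wl x' + wl z < c + d x' z -> d x x' <= b ->
  (wl x).*2 < b.*2 + c.
Proof.
move=> xz x'z xx'; have := d_4pt x x' [::] z; have := d_triangle x' z [::].
have := d_triangle x' x [::].
rewrite !d0 !(dC [::]) !d0 (dC z x') => t1 t2.
rewrite -!muln2; lia.
Qed.

Lemma crossing (P : nat -> bool) n :
  P 0 -> ~~ P n -> exists i, [/\ i < n, P i & ~~ P i.+1].
Proof.
move=> P0; elim: n => [|n IHn] Pn; first by rewrite P0 in Pn.
case: (boolP (P n)) => [Pn'|/IHn[i [lin Pi Pi1]]]; first by exists n.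
by exists i; split=> //; apply: ltnW.
Qed.

(* The path of prefixes of [s ++ t] passes, before and after [s], near the
   point where the geodesic from its start to its end branches off towards the
   endpoint of [s]; the piece in between has bounded length by properness. *)
Lemma bounded_cancellation : proper_length wl ->
  exists B, forall s t, red (s ++ t) -> wl s + wl t <= wl (s ++ t) + B.
Proof.
set L := letter_bound.
case/(_ L.*2) => n0 hn0; exists (L * n0).*2 => s t rst.
set C := wl s + wl t - wl (s ++ t).
case: (posnP C) => [|C0]; first by rewrite /C; lia.
have [i [ltis Pi Pi1]] : exists i, [/\ i < size s,
    C + wl (drop i s ++ t) <= wl (drop i s) + wl t &
    ~~ (C + wl (drop i.+1 s ++ t) <= wl (drop i.+1 s) + wl t)].
  apply: (crossing (P := fun i => C + wl (drop i s ++ t) <= wl (drop i s) + wl t)).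
    by rewrite drop0 /C; lia.
  by rewrite drop_size cat0s (wl_nil wlP); lia.
(* For prefixes of [t] the inequality fails at length 0, since C > 0, and holds at full length; so
   [crossing] is applied to its negation. *)
have [j [ltjt Pj Pj1]] : exists j, [/\ j < size t,
    ~~ (C + wl (s ++ take j t) <= wl s + wl (take j t)) &
    ~~ ~~ (C + wl (s ++ take j.+1 t) <= wl s + wl (take j.+1 t))].
  apply: (crossing (P := fun j => ~~ (C + wl (s ++ take j t) <= wl s + wl (take j t)))).
    by rewrite take0 cats0 (wl_nil wlP); lia.
  by rewrite take_size negbK /C; lia.
have di : d (wv (drop i s)) (wv (drop i.+1 s)) <= L.
  have [l sl] : exists l, drop i s = l :: drop i.+1 s.
    case: s ltis {rst C C0 Pi Pi1 Pj Pj1} => // l s ltis.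
    by exists (nth l (l :: s) i); rewrite -drop_nth.
  rewrite dV sl (@wl_eq _ [:: l]) ?letter_boundP //.
  rewrite -cat1s -catA -reduce_catr ?reduce_catV ?cats0 //; exact: linvK.
have dj : d (take j t) (take j.+1 t) <= L.
  have [l sl] : exists l, take j.+1 t = rcons (take j t) l.
    case: t ltjt {rst C C0 Pi Pi1 Pj Pj1} => // l t ltjt.
    by exists (nth l (l :: t) j); rewrite -take_nth.
  rewrite /d sl (@wl_eq _ [:: l]) ?letter_boundP //.
  rewrite -cats1 catA -reduce_catl ?reduce_Vcat //; exact: linvK.
set x := wv (drop i s) in di; set z := take j.+1 t in dj Pj1.
have x_close : (wl x).*2 < L.*2 + C.
  apply: (branch_close (z := t) _ _ di); rewrite /x !dV !(wl_winv wlP) ?ltnNge //.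
have z_close : (wl z).*2 < L.*2 + C.
  apply: (branch_close (x' := take j t) (z := wv s)).
  - by rewrite dC dV (wl_winv wlP) addnC [_ + wl s]addnC addnC; move: Pj1; rewrite negbK.
  - by rewrite dC dV (wl_winv wlP) [_ + wl s]addnC ltnNge.
  - by rewrite dC.
(* The Gromov products of [x] with [t], of [t] with s^-1 and of s^-1 with [z] are all at least C/2,
   hence so is that of [x] with [z]; and |x|, |z| are less than L + C/2. *)
have short : wl (drop i s ++ z) <= L.*2.
  rewrite -dV -/x.
  have := d_4pt x t z [::]; have := d_4pt t (wv s) z [::].
  have dts : d t (wv s) = wl (s ++ t) by rewrite dC dV.
  have dsz : d (wv s) z = wl (s ++ z) by rewrite dV.
  have dxt : d x t = wl (drop i s ++ t) by rewrite dV.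
  have wx : wl x = wl (drop i s) by rewrite wl_winv.
  move: Pi Pj1 x_close z_close.
  rewrite !d0 dts dsz dxt (wl_winv wlP) -!muln2 wx negbK /C.
  lia.
have red_iz : red (drop i s ++ z).
  move: rst; rewrite -{1}[s](cat_take_drop i) -{1}[t](cat_take_drop j.+1) -catA.
  by case/reduced_cat => _; rewrite catA => /reduced_cat[].
have := hn0 _ red_iz short; rewrite size_cat => small.
(* The Gromov product of [x] and [t] is at least C/2 and at most |x|, which the number of letters
   bounds. *)
have big : C <= (wl (drop i s)).*2.
  have := d_triangle x t [::].
  by move: Pi; rewrite (dC t x) !d0 dV (wl_winv wlP) // -muln2; lia.
have := wl_size (drop i s); rewrite -/L => up.
have : L * size (drop i s) <= L * n0.
  by rewrite leq_mul2l; apply/orP; right; exact: leq_trans (leq_addr _ _) small.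
move: big; rewrite /C -!muln2; lia.
Qed.

(** Equivalently, the cancellations |u| + |v| - |uv| and |v| + |w| - |vw| add up to less than 2|v|:
    the parts of [v] cancelled at its two ends do not meet. *)
Definition block_condition N := forall u v w,
  size u = N -> size v = N -> size w = N -> red (u ++ v ++ w) ->
  wl u + wl w < wl (u ++ v) + wl (v ++ w).

(** The two cancellations at a block total at most 2B, and by properness every long enough block has
    length above 2B. *)
Lemma block_condition_exists : proper_length wl ->
  exists N0, forall N, N0 <= N -> block_condition N.
Proof.
move=> wl_proper; have [B hB] := bounded_cancellation wl_proper.
have [n hn] := wl_proper B.*2; exists n.+1 => N ltnN u v w su sv sw.
move=> r; have [_ rvw] := reduced_cat r.
move: (r); rewrite catA => /reduced_cat[ruv _].
have [_ rv] := reduced_cat ruv.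
have := hB _ _ ruv; have := hB _ _ rvw.
have : B.*2 < wl v.
  by rewrite ltnNge; apply/negP => /(hn _ rv); rewrite sv leqNgt ltnN.
by rewrite -muln2; lia.
Qed.

(* The local condition makes the blocks quasi-geodesic: the branch point of a
   junction of two blocks does not depend on the blocks further away. *)
Lemma block_additive N n t w : 0 < N -> block_condition N ->
  size t = N -> size w = n.+1 * N -> red (t ++ w) ->
  wl (t ++ w) + wl (take N w) = wl (t ++ take N w) + wl w.
Proof.
move=> N0 hN; elim: n t w => [|n IHn] t w st sw r.
  by rewrite take_oversize ?sw ?mul1n.
set u := take N w; set w' := drop N w; set v := take N w'.
have wE : w = u ++ w' by rewrite cat_take_drop.
have su : size u = N by rewrite size_takel // sw mulSn leq_addr.
have sw' : size w' = n.+1 * N by rewrite size_drop sw mulSn; lia.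
have sv : size v = N by rewrite size_takel // sw' mulSn leq_addr.
move: r; rewrite wE => r; have [_ ruw'] := reduced_cat r.
have := IHn u w' su sw' ruw'.
have : wl t + wl v < wl (t ++ u) + wl (u ++ v).
  apply: hN => //; move: r; rewrite -(cat_take_drop N w') !catA.
  by case/reduced_cat.
(* Among the pairings of t^-1, u, uw' and the origin, |t| + |w'| is strictly below |tu| + |uw'|, by
   the block condition and the induction hypothesis. So the remaining sum |tuw'| + |u| equals |tu| +
   |uw'|. *)
have := d_4pt (wv t) u (u ++ w') [::]; have := d_4pt (wv t) (u ++ w') u [::].
rewrite -/v (dC (u ++ w') u).
have -> : d u (u ++ w') = wl w'.
  rewrite /d; apply: wl_eq; rewrite catA -reduce_catl ?reduce_Vcat //; exact: linvK.
rewrite !dV !cats0 !d0 -/u; lia.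
Qed.

End LengthFun.

(** * Enumeration of reduced words *)

Section Words.
Variable k : nat.
Implicit Types (l : letter k) (u v w : seq (letter k)).
Local Notation red := (reduced (@linv k)).
Local Notation wv := (winv (@linv k)).

Definition compatible l w := if w is l' :: _ then l' != linv l else true.

Lemma reduced_consE l w : red (l :: w) = compatible l w && red w.
Proof. by rewrite reduced_cons; case: w. Qed.

Fixpoint words n : seq (seq (letter k)) :=
  if n is n'.+1 then
    flatten [seq [seq l :: w | l <- enum {: letter k} & compatible l w] | w <- words n']
  else [:: [::]].

Lemma mem_words n w : (w \in words n) = (size w == n) && red w.
Proof.
elim: n w => [|n IHn] w /=; first by rewrite inE; case: w.
apply/flattenP/andP => [[_ /mapP[v vn ->] /mapP[l]]|].
  rewrite mem_filter IHn in vn * => /andP[lv _ ->] /=.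
  by case/andP: vn => /eqP -> rv; rewrite eqxx reduced_consE lv.
case: w => [[]//|l w] /= [/eqP[sw] rlw].
move: (rlw); rewrite reduced_consE => /andP[lw rw].
exists [seq l :: w | l <- enum {: letter k} & compatible l w].
  by apply: map_f; rewrite IHn sw eqxx.
by apply: (map_f (fun l => l :: w)); rewrite mem_filter lw mem_enum.
Qed.

Lemma words_uniq n : uniq (words n).
Proof.
elim: n => //= n IHn; elim: (words n) IHn => //= w ws IHws /andP[wws uws].
rewrite cat_uniq IHws // andbT; apply/andP; split.
  by rewrite map_inj_uniq ?filter_uniq -?enumT ?enum_uniq // => ? ? [].
apply/hasPn => v /flattenP[_ /mapP[w' w'ws ->] /mapP[l _ ->]].
by apply/negP => /mapP[l' _ [_ ww']]; rewrite -ww' w'ws in wws.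
Qed.

Lemma count_compatible l w : #|[pred l' | compatible l' (l :: w)]| = (2 * k).-1.
Proof.
rewrite (@eq_card _ _ (predC1 (linv l))) => [|l' ]; last first.
  by rewrite !inE /= eq_sym (inv_eq (@linvK k)) eq_sym.
have := cardC1 (linv l); rewrite card_prod card_ord card_bool mulnC => <-.
by apply: eq_card => l'; rewrite !inE.
Qed.

Lemma card_letter : #|{: letter k}| = 2 * k.
Proof. by rewrite card_prod card_ord card_bool mulnC. Qed.

Lemma big_words_S (V : nmodType) n (f : seq (letter k) -> V) :
  (\sum_(w <- words n.+1) f w =
   \sum_(w <- words n) \sum_(l | compatible l w) f (l :: w))%R.
Proof.
rewrite [words n.+1]/(flatten _) big_flatten big_map; apply: eq_bigr => w _.
by rewrite big_map big_filter big_enum_cond.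
Qed.

Lemma size_wordsS n : size (words n.+1) = 2 * k * (2 * k).-1 ^ n.
Proof.
elim: n => [|n IHn].
  by rewrite /= cats0 size_map filter_predT -cardE card_letter muln1.
rewrite -sum1_size (big_words_S _ (fun=> 1)) (eq_big_seq (fun=> (2 * k).-1)).
  by rewrite big_const_seq count_predT iter_addn_0 IHn expnS mulnCA.
move=> w; rewrite mem_words sum1_card; case: w => // l w _.
exact: (count_compatible l w).
Qed.

(** A nonempty reduced word has K^p reduced extensions by p letters on the left. The empty word has
    more, whence 0 < m. *)
Lemma big_words_drop (R : pzRingType) p m (f : seq (letter k) -> R) : 0 < m ->
  (\sum_(w <- words (p + m)) f (drop p w) =
    ((2 * k).-1 ^ p)%:R * \sum_(w <- words m) f w)%R.
Proof.
move=> m0; elim: p => [|p IHp].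
  by rewrite mul1r; apply: eq_bigr => w _; rewrite drop0.
rewrite addSn big_words_S /= expnS natrM -mulrA -IHp mulr_sumr.
apply: eq_big_seq => w; rewrite mem_words => /andP[/eqP sw _].
rewrite sumr_const mulr_natl; congr (_ *+ _)%R.
case: w sw => [|l w] sw; first by move: sw => /=; lia.
exact: (count_compatible l w).
Qed.

Lemma winv_words n : perm_eq (words n) (map wv (words n)).
Proof.
have wvK := winvK (@linvK k).
apply: uniq_perm; rewrite ?words_uniq // ?map_inj_uniq ?words_uniq //.
  exact: inv_inj.
move=> w; rewrite mem_words; apply/idP/mapP => [|[v + ->]].
  by exists (wv w); rewrite ?wvK // mem_words size_winv reduced_winv //; apply: linvK.
by rewrite mem_words size_winv reduced_winv //; apply: linvK.
Qed.

End Words.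

(** * Words acting on a tree *)

Section WordVal.
Variables (F : groupType) (k : nat) (a : 'I_k -> F).
Implicit Types s t : seq (letter k).
Local Notation val := (word_val a).
Local Notation red := (reduced (@linv k)).
Local Notation wv := (winv (@linv k)).

Lemma letter_val_linv l : letter_val a (linv l) = ((letter_val a l)^-1)%g.
Proof. by case: l => i []; rewrite /letter_val /= ?invgK. Qed.

Lemma word_val_nil : val [::] = 1%g.
Proof. by rewrite /word_val big_nil. Qed.

Lemma word_val_cons l s : val (l :: s) = (letter_val a l * val s)%g.
Proof. by rewrite /word_val big_cons. Qed.

Lemma word_val1 l : val [:: l] = letter_val a l.
Proof. by rewrite /word_val big_seq1. Qed.

Lemma word_val_cat s t : val (s ++ t) = (val s * val t)%g.
Proof. by rewrite /word_val big_cat. Qed.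

Lemma word_val_winv s : val (wv s) = ((val s)^-1)%g.
Proof.
elim: s => [|l s IHs]; first by rewrite word_val_nil invg1.
by rewrite winv_cons -cats1 word_val_cat IHs word_val1 letter_val_linv word_val_cons invgM.
Qed.

Lemma word_val_reduce s : val (reduce (@linv k) s) = val s.
Proof.
rewrite reduceE; elim: s => //= l s IHs; rewrite word_val_cons -IHs.
case: (foldr _ _ _) => [|l' r]; first by rewrite word_val_cons.
rewrite /push; case: eqP => [->|_]; last by rewrite !word_val_cons.
by rewrite word_val_cons letter_val_linv mulgA mulgV mul1g.
Qed.

Hypothesis ha : free_basis a.

Lemma word_val_inj s t : red s -> red t -> val s = val t -> s = t.
Proof.
move=> rs rt st; have [u [_ hu]] := ha (val s).
by rewrite -(hu s) // -(hu t).
Qed.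

Lemma word_val_surj g : exists2 s, red s & val s = g.
Proof. by have [s [[rs sg] _]] := ha g; exists s. Qed.

Lemma letter_val_neq1 l : letter_val a l <> 1%g.
Proof.
by rewrite -word_val1 -word_val_nil => /(word_val_inj (isT : red [:: l]) (isT : red [::])).
Qed.

End WordVal.

Section Action.
Variables (F : groupType) (X : sgraph) (hX : simplicial_tree X) (phi : action F X).
Implicit Types (g h : F) (u v : vert X) (e : edge X) (s : seq (edge X)).
Local Notation dist := (dist hX).
Local Notation geod := (geod hX).

Lemma actVK g : cancel (actV phi g) (actV phi g^-1%g).
Proof. by move=> v; rewrite -actVM mulVg actV1. Qed.

Lemma actVKV g : cancel (actV phi g^-1%g) (actV phi g).
Proof. by move=> v; rewrite -actVM mulgV actV1. Qed.

Lemma actEK g : cancel (actE phi g) (actE phi g^-1%g).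
Proof. by move=> v; rewrite -actEM mulVg actE1. Qed.

Lemma act_term g e : term (actE phi g e) = actV phi g (term e).
Proof. by rewrite /term act_einv act_orig. Qed.

Lemma edge_path_act g u v s :
  edge_path u s v -> edge_path (actV phi g u) (map (actE phi g) s) (actV phi g v).
Proof.
elim: s u => [u /eqP ->|e s IHs u] /=; first exact: eqxx.
by case/andP => /eqP <- /IHs; rewrite act_orig act_term eqxx.
Qed.

Lemma geod_act g u v : geod (actV phi g u) (actV phi g v) = map (actE phi g) (geod u v).
Proof.
symmetry; apply: reduced_geod; first exact/edge_path_act/geod_path.
rewrite -[geod u v](reduce_id (geod_reduced hX u v)).
rewrite -(reduce_map _ (can_inj (actEK g)) (invU := @einv X)) ?reduce_reduced //.
by move=> e; rewrite act_einv.
Qed.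

Lemma dist_act g u v : dist (actV phi g u) (actV phi g v) = dist u v.
Proof. by rewrite /dist geod_act size_map. Qed.

Variables (k : nat) (a : 'I_k -> F).

Definition wlen (x0 : vert X) (s : seq (letter k)) : nat :=
  dist x0 (actV phi (word_val a s) x0).

Lemma wlen_length_fun x0 : length_fun (wlen x0).
Proof.
have dE (u v : seq (letter k)) : wlen x0 (winv (@linv k) u ++ v) =
    dist (actV phi (word_val a u) x0) (actV phi (word_val a v) x0).
  by rewrite /wlen word_val_cat word_val_winv -(dist_act (word_val a u)) actVM actVKV.
split.
- by move=> s; rewrite /wlen word_val_reduce.
- by rewrite /wlen word_val_nil actV1 distvv.
- by move=> s; rewrite -[winv _ s]cats0 dE word_val_nil actV1 distC.
- move=> s t; rewrite /wlen word_val_cat actVM.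
  by rewrite -(dist_act (word_val a s) x0 (actV _ (word_val a t) _)) dist_triangle.
by move=> x y z w /=; rewrite !dE; apply: dist_4pt.
Qed.

Lemma wlen_basepoint x y (s : seq (letter k)) : wlen x s <= wlen y s + (dist x y).*2.
Proof.
rewrite /wlen; set g := word_val a s.
have := dist_triangle hX y x (actV phi g x).
have := dist_triangle hX (actV phi g y) y (actV phi g x).
by rewrite dist_act [dist y x]distC -muln2; lia.
Qed.

End Action.

(** * Growth of the orbit *)

Lemma size_sum_count (T U : eqType) (f : T -> U) (s : seq T) (r : seq U) :
  uniq r -> {subset map f s <= r} ->
  size s = \sum_(y <- r) count (fun x => f x == y) s.
Proof.
move=> ur sr; under eq_bigr do rewrite -sum1_count big_mkcond.
rewrite exchange_big /= -sum1_size; apply: eq_big_seq => x xs.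
rewrite -big_mkcond /= (eq_bigl (pred1 (f x))); last by move=> y; rewrite eq_sym.
by rewrite -big_filter filter_pred1_uniq ?big_seq1 // sr // map_f.
Qed.

Lemma size_fiber_le (T U : eqType) (f : T -> U) (s : seq T) (m n : nat) :
  size (undup (map f s)) <= m ->
  (forall y, y \in map f s -> count (fun x => f x == y) s <= n) ->
  size s <= m * n.
Proof.
move=> hm hn; rewrite (@size_sum_count _ _ f s (undup (map f s))) ?undup_uniq //; last first.
  by move=> y; rewrite mem_undup.
apply: (@leq_trans (\sum_(y <- undup (map f s)) n)).
  rewrite big_seq_cond [X in _ <= X]big_seq_cond; apply: leq_sum => y.
  by rewrite andbT mem_undup => /hn.
by rewrite big_const_seq count_predT iter_addn_0 mulnC leq_mul2r hm orbT.
Qed.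

Section Growth.
Variables (F : groupType) (X : sgraph) (hX : simplicial_tree X) (phi : action F X).
Hypothesis phi_free : free_action phi.
Hypothesis phi_noinv : without_inversions phi.
Variables (k : nat) (hk : 1 < k) (a : 'I_k -> F).
Hypothesis ha : free_basis a.
Implicit Types (g h : F) (u v : vert X) (e f : edge X) (s : seq (edge X)) (l : letter k).
Local Notation dist := (dist hX).
Local Notation geod := (geod hX).
Local Notation lv := (letter_val a).

Variable x0 : vert X.
Hypothesis x0_min : forall v,
  \sum_i dist x0 (actV phi (a i) x0) <= \sum_i dist v (actV phi (a i) v).

Definition orbV u v := `[< exists g, v = actV phi g u >].
Definition orbE e f := `[< exists g, f = actE phi g e >].

Lemma orbV_act g u v : orbV (actV phi g u) v = orbV u v.
Proof.
apply/asboolP/asboolP => -[h ->]; first by exists (h * g)%g; rewrite actVM.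
by exists (h * g^-1)%g; rewrite actVM actVK.
Qed.

Lemma orbE_act g e f : orbE (actE phi g e) f = orbE e f.
Proof.
apply/asboolP/asboolP => -[h ->]; first by exists (h * g)%g; rewrite actEM.
by exists (h * g^-1)%g; rewrite actEM actEK.
Qed.

(** A finite list, possibly with repetitions, whose translates cover the subtree spanned by the
    orbit of [x0]. *)
Definition hull_edges := flatten [seq geod x0 (actV phi (lv l) x0) | l <- enum {: letter k}].
Local Notation S0 := hull_edges.
Definition hull_verts := x0 :: map (@orig X) S0 ++ map (@term X) S0.
Local Notation V0 := hull_verts.
Definition hull e := has (orbE e) S0.
(** An orbit is named by the position of its first representative, so the quotient graph is handled
    through numbers. All edges outside the hull share the name [size S0]. *)
Definition ecl e := find (orbE e) S0.
Definition vcl v := find (orbV v) V0.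

Lemma hull_edgesP e :
  reflect (exists l, e \in geod x0 (actV phi (lv l) x0)) (e \in S0).
Proof.
apply: (iffP flatten_mapP) => [[l _ el]|[l el]]; first by exists l.
by exists l; rewrite ?mem_enum.
Qed.

Lemma hullP e : reflect (exists g, exists2 f, f \in S0 & e = actE phi g f) (hull e).
Proof.
apply: (iffP hasP) => [[f fS /asboolP[g fE]]|[g [f fS ->]]].
  by exists g^-1%g, f; rewrite // fE actEK.
by exists f => //; apply/asboolP; exists g^-1%g; rewrite actEK.
Qed.

Lemma hull_act g e : hull (actE phi g e) = hull e.
Proof. by apply: eq_has => f; rewrite orbE_act. Qed.

Lemma ecl_act g e : ecl (actE phi g e) = ecl e.
Proof. by apply: eq_find => f; rewrite orbE_act. Qed.

Lemma vcl_act g v : vcl (actV phi g v) = vcl v.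
Proof. by apply: eq_find => f; rewrite orbV_act. Qed.

Lemma ecl_nth e : hull e -> exists g, nth e S0 (ecl e) = actE phi g e.
Proof. by move=> /(nth_find e)/asboolP. Qed.

Lemma ecl_eq e f : hull e -> ecl e = ecl f -> exists g, f = actE phi g e.
Proof.
move=> he ef; have hf : hull f.
  by move: he; rewrite /hull !has_find => he; rewrite -/(ecl f) -ef.
have [g eg] := ecl_nth he; have [h fh] := ecl_nth hf.
exists (h^-1 * g)%g; rewrite actEM -eg (set_nth_default f) -?has_find //.
by rewrite ef fh actEK.
Qed.

Lemma hull_S0 e : e \in S0 -> hull e.
Proof. by move=> eS; apply/hullP; exists 1%g, e; rewrite ?actE1. Qed.

Lemma geod_letterV l :
  geod x0 (actV phi (lv (linv l)) x0) =
  winv (@einv X) (map (actE phi (lv (linv l))) (geod x0 (actV phi (lv l) x0))).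
Proof.
rewrite -geod_act -geodC letter_val_linv actVK; congr geod.
Qed.

Lemma mem_winv s e : (e \in winv (@einv X) s) = (einv e \in s).
Proof.
rewrite /winv mem_rev; apply/mapP/idP => [[f fs ->]|es]; first by rewrite einvK.
by exists (einv e); rewrite ?einvK.
Qed.

Lemma hull_einv e : hull e -> hull (einv e).
Proof.
case/hullP => g [f /hull_edgesP[l fl] ->]; rewrite act_einv hull_act.
rewrite -(hull_act (lv (linv l))); apply: hull_S0.
apply/hull_edgesP; exists (linv l); rewrite geod_letterV mem_winv.
by rewrite act_einv einvK map_f.
Qed.

Lemma hull_geod g : all hull (geod x0 (actV phi g x0)).
Proof.
have [s _ <-] := word_val_surj ha g; elim: s => [|l s IHs].
  by rewrite word_val_nil actV1 -(@reduce_geod _ hX x0 x0 [::] (eqxx _)).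
have p1 := geod_path hX x0 (actV phi (lv l) x0).
have p2 := edge_path_act phi (lv l) (geod_path hX x0 (actV phi (word_val a s) x0)).
rewrite word_val_cons actVM; move: (p2); rewrite -(edge_path_cat _ _ p1) => p.
rewrite -(reduce_geod hX p).
apply/allP => e /mem_reduce; rewrite mem_cat => /orP[el|].
  by apply/hull_S0/hull_edgesP; exists l.
by case/mapP => f /(allP IHs) hf ->; rewrite hull_act.
Qed.

Lemma act_letter_neq l v : actV phi (lv l) v <> v.
Proof. by move/phi_free; apply: letter_val_neq1. Qed.

Lemma hull_first l : exists e s, geod x0 (actV phi (lv l) x0) = e :: s /\ orig e = x0.
Proof.
have := geod_path hX x0 (actV phi (lv l) x0).
case: (geod _ _) => [/eqP/esym/act_letter_neq//|e s /= /andP[/eqP ex _]].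
by exists e, s.
Qed.

(* If all geodesics from [x0] to its translates by letters started with the
   same edge, then its other endpoint would be a better base point. *)
Lemma hull_branch_x0 e : orig e = x0 ->
  exists2 f, f != e & hull f /\ orig f = x0.
Proof.
move=> ex; apply: contrapT => none.
have only l : exists s, geod x0 (actV phi (lv l) x0) = e :: s.
  have [f [s [E fx]]] := hull_first l; exists s; rewrite E; congr (_ :: _).
  apply/eqP; apply: contrapT => /negP fe; apply: none; exists f => //.
  by split=> //; apply/hull_S0/hull_edgesP; exists l; rewrite E mem_head.
have := x0_min (term e); apply/negP; rewrite -ltnNge.
(* The geodesic to a_i x0 starts with [e] and, since the one to a_i^-1 x0 does too, ends with the
   reverse of a_i e. Stripping both edges leaves a path from [term e] to its translate. *)
have better i : dist (term e) (actV phi (a i) (term e)) < dist x0 (actV phi (a i) x0).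
  have [s E] := only (i, false); have [s' E'] := only (i, true).
  have p := geod_path hX x0 (actV phi (lv (i, false)) x0).
  have := geod_letterV (i, true); rewrite -[linv (i, true)]/(i, false) E' /= winv_cons.
  rewrite -[a i]/(lv (i, false)) {2}/dist E in p *.
  case/lastP: s E p => [|s f] E p.
    (* If [e] were the whole geodesic, a_i would invert it. *)
    case: (winv _ _) => [[eE]|? [] //].
    by have := phi_noinv (lv (i, false)) e; rewrite [in einv e]eE einvK eqxx.
  rewrite -rcons_cons => /rcons_inj[_ fE].
  have p' : edge_path (term e) (s ++ [:: f]) (actV phi (lv (i, false)) x0).
    by case/andP: p => _; rewrite cats1.
  have [y p1] := edge_path_split p'.
  rewrite /= => /andP[/eqP fy _].
  apply: (@leq_ltn_trans (size s)); last by rewrite /= size_rcons.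
  by apply: dist_le; rewrite -act_term -[term (actE _ _ e)]/(orig (einv _)) -fE fy.
rewrite (bigD1 (Ordinal (ltnW hk))) //= [X in _ < X](bigD1 (Ordinal (ltnW hk))) //=.
by rewrite -addSn leq_add ?better // leq_sum // => i _; apply/ltnW/better.
Qed.

(** Inside a geodesic the reverse of the preceding edge is a second direction; minimality of [x0] is
    only called upon at the start of the geodesic. *)
Lemma hull_branch e : hull e ->
  exists2 f, f != e & hull f /\ orig f = orig e.
Proof.
case/hullP => g [e' eS ->].
suff [f fe [hf fo]] : exists2 f, f != e' & hull f /\ orig f = orig e'.
  exists (actE phi g f); first by rewrite (can_eq (actEK phi g)).
  by rewrite hull_act !act_orig fo.
have [l el] := hull_edgesP _ eS.
have p := geod_path hX x0 (actV phi (lv l) x0).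
have r := geod_reduced hX x0 (actV phi (lv l) x0).
have hS f : f \in geod x0 (actV phi (lv l) x0) -> hull f.
  by move=> fl; apply/hull_S0/hull_edgesP; exists l.
move: p r hS; case/splitPr: el => s1 s2; case/lastP: s1 => [|s1 f] /=.
  by move=> /andP[/eqP ex _] _ _; rewrite ex; apply: hull_branch_x0.
move=> /edge_path_split[v p1 /= /andP[/eqP ev _]] r hS.
exists (einv f).
  move: r; rewrite reduced_rcons_cat => /and3P[_ + _]; by rewrite eq_sym.
split; first by apply/hull_einv/hS; rewrite mem_cat mem_rcons mem_head.
move: p1; rewrite -cats1 => /edge_path_split[w _] /= /andP[_ /eqP fv].
by rewrite ev -fv.
Qed.

(** * Euler characteristic and degrees of the quotient of the hull *)

Definition pcl e := minn (ecl e) (ecl (einv e)).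
Definition edge_classes := undup (map ecl S0).
Definition uedge_classes := undup (map pcl S0).
Definition vert_classes := undup (map vcl V0).

Lemma pcl_act g e : pcl (actE phi g e) = pcl e.
Proof. by rewrite /pcl act_einv !ecl_act. Qed.

Lemma pcl_einv e : pcl (einv e) = pcl e.
Proof. by rewrite /pcl einvK minnC. Qed.

Lemma size_edge_classes : size edge_classes <= (size uedge_classes).*2.
Proof.
have [e0 _] : exists e0, e0 \in S0.
  have [e [s [E _]]] := hull_first (Ordinal (ltnW hk), false).
  by exists e; apply/hull_edgesP; exists (Ordinal (ltnW hk), false); rewrite E mem_head.
pose rev c := ecl (einv (nth e0 S0 c)).
rewrite -addnn -[X in _ <= _ + X](size_map rev) -size_cat.
apply: uniq_leq_size => [|c]; first exact: undup_uniq.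
rewrite mem_undup => /mapP[e eS ->]; rewrite mem_cat.
have pe : pcl e \in uedge_classes by rewrite mem_undup map_f.
case: (leqP (ecl e) (ecl (einv e))) => le; apply/orP; [left|right].
  by move: pe; rewrite /pcl (minn_idPl le).
apply/mapP; exists (pcl e) => //; rewrite /pcl (minn_idPr (ltnW le)) /rev.
have [g eg] := ecl_nth (hull_einv (hull_S0 eS)).
rewrite (set_nth_default (einv e)); first by rewrite eg act_einv einvK ecl_act.
by rewrite -has_find; apply/hull_einv/hull_S0.
Qed.

(** A bit string is a 1-cochain over F_2 on the unoriented edges of the quotient. [parity]
    integrates it along a path and is unchanged by cancellation and by the action. *)
Definition cochain (t : seq bool) e := nth false t (index (pcl e) uedge_classes).
Definition parity t s := foldr (fun e b => cochain t e (+) b) false s.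

Lemma cochain_einv t e : cochain t (einv e) = cochain t e.
Proof. by rewrite /cochain pcl_einv. Qed.

Lemma parity_cat t s1 s2 : parity t (s1 ++ s2) = parity t s1 (+) parity t s2.
Proof. by elim: s1 => //= e s1 ->; rewrite addbA. Qed.

Lemma parity_act t g s : parity t (map (actE phi g) s) = parity t s.
Proof. by elim: s => //= e s ->; rewrite /cochain pcl_act. Qed.

Lemma parity_winv t s : parity t (winv (@einv X) s) = parity t s.
Proof.
elim: s => //= e s IHs; rewrite winv_cons -cats1 parity_cat IHs /=.
by rewrite cochain_einv addbF addbC.
Qed.

Lemma parity_reduce t s : parity t (reduce (@einv X) s) = parity t s.
Proof.
rewrite reduceE; elim: s => //= e s <-; case: (foldr _ _ _) => //= f r.
by case: eqP => //= ->; rewrite cochain_einv addbA addbb.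
Qed.

Lemma parity_geod t u v s : edge_path u s v -> parity t (geod u v) = parity t s.
Proof. by move=> p; rewrite -(reduce_geod hX p) parity_reduce. Qed.

(* The first [k] geodesics represent generators of the fundamental group of the
   quotient graph, the others join [x0] to the other vertices of the quotient. *)
Definition test_paths :=
  [seq geod x0 (actV phi (a i) x0) | i <- enum 'I_k] ++
  [seq geod x0 (nth x0 V0 c) | c <- rem 0 vert_classes].

Lemma vcl_x0 : vcl x0 = 0.
Proof.
by rewrite /vcl /= ifT //; apply/asboolP; exists 1%g; rewrite actV1.
Qed.

Lemma vcl_nth v : v \in V0 -> exists g, nth x0 V0 (vcl v) = actV phi g v.
Proof.
move=> vV; have : has (orbV v) V0.
  by apply/hasP; exists v => //; apply/asboolP; exists 1%g; rewrite actV1.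
by move/(nth_find x0)/asboolP.
Qed.

Lemma size_test_paths : size test_paths = k + (size vert_classes).-1.
Proof.
rewrite size_cat !size_map -enumT size_enum_ord size_rem //.
by rewrite mem_undup; apply/mapP; exists x0; rewrite ?vcl_x0 ?mem_head.
Qed.

(** The relation [good] is an equivalence invariant under the action. The tests relate [x0] to its
    orbit and to a representative of each vertex class, hence to all of [V0]; an edge of [S0] joins
    two vertices of [V0], so its bit is determined. *)
Lemma parity_inj t t' : size t = size uedge_classes -> size t' = size uedge_classes ->
  map (parity t) test_paths = map (parity t') test_paths -> t = t'.
Proof.
move=> st st' /eq_in_map test.
pose good u v := parity t (geod u v) = parity t' (geod u v).
have good_trans v u w : good u v -> good v w -> good u w.
  rewrite /good => uv vw; have p := geod_path hX v w.
  rewrite -(edge_path_cat _ _ (geod_path hX u v)) in p.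
  by rewrite !(parity_geod _ p) !parity_cat uv vw.
have good_sym u v : good u v -> good v u by rewrite /good geodC !parity_winv.
have good_act g u v : good u v -> good (actV phi g u) (actV phi g v).
  by rewrite /good geod_act !parity_act.
have good_a i : good x0 (actV phi (a i) x0).
  apply: (test (geod x0 (actV phi (a i) x0))); rewrite mem_cat; apply/orP; left.
  by apply: (map_f (fun i => geod x0 (actV phi (a i) x0))); rewrite mem_enum.
have good_letter l : good x0 (actV phi (lv l) x0).
  case: l => i [|]; last exact: good_a.
  by apply: good_sym; have := good_act (a i)^-1%g _ _ (good_a i); rewrite actVK.
have good_orbit g : good x0 (actV phi g x0).
  have [s _ <-] := word_val_surj ha g; elim: s => [|l s IHs].
    rewrite word_val_nil actV1 /good !(@parity_geod _ x0 x0 [::]) //; exact: eqxx.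
  by rewrite word_val_cons actVM; apply: good_trans (good_letter l) (good_act _ _ _ IHs).
have good_V0 v : v \in V0 -> good x0 v.
  move=> vV; have [g vg] := vcl_nth vV.
  have good_rep : good x0 (nth x0 V0 (vcl v)).
    case: (eqVneq (vcl v) 0) => [->|v0].
      rewrite /good !(@parity_geod _ x0 x0 [::]) //; exact: eqxx.
    apply: (test (geod x0 (nth x0 V0 (vcl v)))); rewrite mem_cat; apply/orP; right.
    apply: (map_f (fun c => geod x0 (nth x0 V0 c))).
    by rewrite mem_rem_uniq ?undup_uniq // inE v0 mem_undup map_f.
  rewrite vg in good_rep; have := good_act g^-1%g _ _ good_rep.
  by rewrite actVK; apply: good_trans; apply: good_orbit.
apply: (@eq_from_nth _ false) => [|i]; first by rewrite st'.
rewrite st => ltiP.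
have : nth 0 uedge_classes i \in uedge_classes by rewrite mem_nth.
rewrite mem_undup => /mapP[e eS Ei].
have iE : index (pcl e) uedge_classes = i by rewrite -Ei index_uniq ?undup_uniq.
have : good (orig e) (term e).
  apply: (good_trans x0).
    by apply/good_sym/good_V0; rewrite inE mem_cat map_f ?orbT.
  by apply: good_V0; rewrite inE mem_cat map_f ?orbT.
have p : edge_path (orig e) [:: e] (term e) by rewrite /= !eqxx.
by rewrite /good !(parity_geod _ p) /= !addbF /cochain iE.
Qed.

(** With P edges and V vertices in the quotient, the 2^P cochains inject into 2^(k + V - 1) test
    results. This dimension count over F_2 gives P - V + 1 <= k without computing a fundamental
    group. *)
Lemma euler_characteristic : size uedge_classes <= k + (size vert_classes).-1.
Proof.
set P := size uedge_classes; rewrite -size_test_paths.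
pose f (t : P.-tuple bool) := map_tuple (parity t) (in_tuple test_paths).
have f_inj : injective f.
  move=> t t' /(congr1 val) /= ff; apply: val_inj.
  by apply: parity_inj; rewrite ?size_tuple.
have := leq_card f f_inj; rewrite !card_tuple card_bool leq_exp2l //.
Qed.

Lemma hull_ecl e : hull e -> ecl e \in edge_classes.
Proof.
case/hullP => g [f fS ->].
by rewrite ecl_act mem_undup map_f.
Qed.

(** Freeness: an element carrying [e] to [f] fixes their common origin. So the star of a vertex
    embeds in the quotient. *)
Lemma ecl_inj_orig e f : hull e -> orig e = orig f -> ecl e = ecl f -> e = f.
Proof.
move=> he oef /(ecl_eq he)[g fE].
have : actV phi g (orig e) = orig e by rewrite -act_orig -fE oef.
by move/phi_free => g1; rewrite fE g1 actE1.
Qed.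

Lemma uniq_map_ecl (v : vert X) (es : seq (edge X)) : uniq es ->
  (forall e, e \in es -> hull e /\ orig e = v) -> uniq (map ecl es).
Proof.
move=> ues hes; rewrite map_inj_in_uniq // => e f /hes[he eo] /hes[_ fo].
by apply: ecl_inj_orig; rewrite ?eo.
Qed.

(** The degrees of the quotient add up to at most 2P <= 2k + 2(V - 1). Each of the other V - 1
    vertices uses at least 2 of this, which leaves 2k for the class of [v]. *)
Lemma hull_degree v (es : seq (edge X)) : uniq es ->
  (forall e, e \in es -> hull e /\ orig e = v) -> size es <= 2 * k.
Proof.
case: es => // e0 es0; set es := e0 :: es0 => ues hes.
pose ov c := vcl (orig (nth e0 S0 c)).
have ovE e : hull e -> ov (ecl e) = vcl (orig e).
  move=> he; have [g eg] := ecl_nth he.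
  rewrite /ov (set_nth_default e); first by rewrite eg act_orig vcl_act.
  by rewrite -has_find.
have many (u : vert X) (fs : seq (edge X)) : uniq fs ->
    (forall e, e \in fs -> hull e /\ orig e = u) ->
    size fs <= count (fun d => ov d == vcl u) edge_classes.
  move=> ufs hfs; rewrite -(size_map ecl) -size_filter.
  apply: uniq_leq_size; first exact: uniq_map_ecl ufs hfs.
  move=> c /mapP[e /hfs[he <-] ->]; rewrite mem_filter hull_ecl // andbT.
  by rewrite ovE.
have [h0 o0] : hull e0 /\ orig e0 = v by apply: hes; rewrite mem_head.
have vv : vcl v \in vert_classes.
  have [g [f fS fE]] := hullP _ h0.
  rewrite -o0 fE act_orig vcl_act mem_undup map_f // inE mem_cat.
  by rewrite map_f ?orbT.
have two c : c \in vert_classes -> 2 <= count (fun d => ov d == c) edge_classes.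
  rewrite mem_undup => /mapP[u uV ->].
  have [e he eu] : exists2 e, hull e & orig e = u.
    move: uV; rewrite inE mem_cat => /or3P[/eqP->|/mapP[e eS ->]|/mapP[e eS ->]].
    - have [e [s [E ex]]] := hull_first (Ordinal (ltnW hk), false).
      exists e => //; apply/hull_S0/hull_edgesP.
      by exists (Ordinal (ltnW hk), false); rewrite E mem_head.
    - by exists e; rewrite // hull_S0.
    - by exists (einv e); rewrite // hull_einv ?hull_S0.
  have [f fe [hf fo]] := hull_branch he.
  apply: (many u [:: e; f]); first by rewrite /= inE eq_sym fe.
  by move=> d; rewrite !inE => /orP[] /eqP ->; rewrite ?fo.
have := size_edge_classes; have := euler_characteristic.
rewrite (@size_sum_count _ _ ov edge_classes vert_classes) ?undup_uniq //; last first.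
  move=> c /mapP[d]; rewrite mem_undup => /mapP[e eS ->] ->.
  rewrite ovE ?hull_S0 // mem_undup map_f // inE mem_cat map_f ?orbT //.
rewrite (big_rem (vcl v)) //=.
have : (size vert_classes).-1 * 2 <=
    \sum_(c <- rem (vcl v) vert_classes) count (fun d => ov d == c) edge_classes.
  rewrite -(size_rem vv) mulnC -iter_addn_0 -(count_predT (rem _ _)) -big_const_seq.
  rewrite big_seq_cond [X in _ <= X]big_seq_cond; apply: leq_sum => c.
  by rewrite andbT => /mem_rem/two.
have := many v es ues hes; have : 0 < size vert_classes by case: vert_classes vv.
have -> : size es = (size es0).+1 by [].
move: (count _ _) (\sum_(c <- _) _) (size es0) => A S n.
move: (size vert_classes) (size uedge_classes) => V P.
rewrite -!muln2; lia.
Qed.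

Lemma size_hull_paths e (qs : seq (seq (edge X))) r : hull e -> uniq qs ->
  (forall q, q \in qs -> [/\ size q = r, reduced (@einv X) (e :: q), all hull q &
     exists v, edge_path (term e) q v]) ->
  size qs <= (2 * k).-1 ^ r.
Proof.
elim: r e qs => [|r IHr] e qs he uqs hqs.
  rewrite expn0 (@uniq_leq_size _ qs [:: [::]]) // => q /hqs[/size0nil -> _ _ _].
  by rewrite inE.
rewrite expnS; apply: (@size_fiber_le _ _ (head e)) => [|f /mapP[q0 /hqs[]]].
  (* The reverse of [e] occupies one of the at most 2k directions, and no reduced continuation takes
     it. *)
  suff : size (einv e :: undup (map (head e) qs)) <= 2 * k by rewrite /=; lia.
  apply: (@hull_degree (term e)).
    rewrite /= undup_uniq andbT mem_undup; apply/mapP => -[[|f q] /hqs[//= _ r1 _ _] ef].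
    by move: r1; rewrite reduced_cons -ef eqxx.
  move=> f; rewrite inE mem_undup => /orP[/eqP ->|/mapP[[|f' q] /hqs[//= _ _ /andP[hf _] [v]]]].
    by rewrite hull_einv.
  by move=> /andP[/eqP fe _] ->.
case: q0 => //= f0 q0 _ _ /andP[hf _] _ ->.
rewrite -size_filter -(size_map behead); apply: (IHr f0) => //.
  rewrite map_inj_in_uniq ?filter_uniq // => q1 q2.
  rewrite !mem_filter => /andP[/eqP h1 /hqs[s1 _ _ _]] /andP[/eqP h2 /hqs[s2 _ _ _]].
  case: q1 q2 s1 s2 h1 h2 => [|f1 q1] [|f2 q2] //= _ _ -> -> -> //.
move=> _ /mapP[q + ->]; rewrite mem_filter => /andP[/eqP qf /hqs[]].
case: q qf => //= f1 q -> [sq] rq /andP[_ hq] [v /andP[_ p]].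
by split=> //; [exact: reduced_behead rq|exists v].
Qed.

(** By freeness an element is determined by its geodesic, which has at most 2k choices for the first
    edge and K for each later one. *)
Lemma growth_bound r (gs : seq F) : uniq gs ->
  (forall g, g \in gs -> dist x0 (actV phi g x0) = r) ->
  size gs <= 2 * k * (2 * k).-1 ^ r.
Proof.
move=> ugs hgs; pose qs := map (fun g => geod x0 (actV phi g x0)) gs.
have uqs : uniq qs.
  rewrite map_inj_uniq // => g h gh.
  have := geod_path hX x0 (actV phi h x0); rewrite -gh.
  move=> /(edge_path_target (geod_path hX x0 (actV phi g x0))) ghx.
  have : actV phi (h^-1 * g)%g x0 = x0 by rewrite actVM ghx actVK.
  by move/phi_free => /(congr1 (fun x => (h * x)%g)); rewrite mulgA mulgV mul1g mulg1.
have hqs q : q \in qs -> [/\ size q = r, reduced (@einv X) q, all hull q &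
    exists v, edge_path x0 q v].
  case/mapP => g /hgs gr ->; split; rewrite ?geod_reduced ?hull_geod //.
  by eexists; apply: geod_path.
rewrite -(size_map (fun g => geod x0 (actV phi g x0))) -/qs.
case: r hgs hqs => [|r] hgs hqs.
  apply: (@leq_trans 1); last by rewrite expn0; lia.
  rewrite (@uniq_leq_size _ qs [:: [::]]) // => q /hqs[/size0nil -> _ _ _].
  by rewrite inE.
have [e0 _] : exists e, hull e.
  have [e [s [E _]]] := hull_first (Ordinal (ltnW hk), false).
  exists e; apply/hull_S0/hull_edgesP.
  by exists (Ordinal (ltnW hk), false); rewrite E mem_head.
apply: (@leq_trans (2 * k * (2 * k).-1 ^ r)); last by rewrite leq_mul2l leq_pexp2l ?orbT //; lia.
apply: (@size_fiber_le _ _ (head e0)) => [|f /mapP[q0 /hqs[]]].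
  apply: (@hull_degree x0); first exact: undup_uniq.
  move=> f; rewrite mem_undup => /mapP[[|f' q] /hqs[//= _ _ /andP[hf _] [v]]].
  by move=> /andP[/eqP fe _] ->.
case: q0 => //= f0 q0 _ _ /andP[hf _] _ ->.
rewrite -size_filter -(size_map behead); apply: (@size_hull_paths f0) => //.
  rewrite map_inj_in_uniq ?filter_uniq // => q1 q2.
  rewrite !mem_filter => /andP[/eqP h1 /hqs[s1 _ _ _]] /andP[/eqP h2 /hqs[s2 _ _ _]].
  case: q1 q2 s1 s2 h1 h2 => [|f1 q1] [|f2 q2] //= _ _ -> -> -> //.
move=> _ /mapP[q + ->]; rewrite mem_filter => /andP[/eqP qf /hqs[]].
case: q qf => //= f1 q -> [sq] rq /andP[_ hq] [v /andP[_ p]].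
by split=> //; exists v.
Qed.

End Growth.

(** A repetition-free list of short words of maximal size contains all of them, so its longest
    member bounds the rest. *)
Lemma finite_length_proper k (wl : seq (letter k) -> nat) (M : nat -> nat) :
  (forall r (ws : seq (seq (letter k))), uniq ws ->
    {in ws, forall w, reduced (@linv k) w /\ wl w <= r} -> size ws <= M r) ->
  proper_length wl.
Proof.
move=> hM r.
pose P n := `[< exists ws : seq (seq (letter k)), [/\ uniq ws, size ws = n &
  {in ws, forall w, reduced (@linv k) w /\ wl w <= r}] >].
have P0 : exists n, P n by exists 0%N; apply/asboolP; exists [::].
have PM n : P n -> n <= M r by move/asboolP => [ws [u <- h]]; apply: hM.
have [n /asboolP[ws [uws sws hws]] nmax] := ex_maxnP P0 PM.
exists (\max_(w <- ws) size w) => s rs lsr.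
case: (boolP (s \in ws)) => [sin|snin]; first exact: leq_bigmax_seq.
suff /nmax : P n.+1 by rewrite ltnn.
apply/asboolP; exists (s :: ws); split; rewrite /= ?snin ?sws //.
by move=> w; rewrite inE => /orP[/eqP ->|/hws].
Qed.

(** * Properness, and a lower bound for the mean length *)

Section FreeAction.
Variables (F : groupType) (X : sgraph) (hX : simplicial_tree X) (phi : action F X).
Hypothesis phi_free : free_action phi.
Hypothesis phi_noinv : without_inversions phi.
Variables (k : nat) (hk : 1 < k) (a : 'I_k -> F).
Hypothesis ha : free_basis a.
Local Notation dist := (dist hX).
Local Notation wlen := (wlen hX phi a).
Local Notation K := (2 * k).-1.

Lemma minimal_basepoint : exists x0, forall v,
  \sum_i dist x0 (actV phi (a i) x0) <= \sum_i dist v (actV phi (a i) v).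
Proof.
pose f v := \sum_i dist v (actV phi (a i) v).
have [v0] : inhabited (vert X) by case: hX.
have ex : exists n, `[< exists v, f v = n >] by exists (f v0); apply/asboolP; exists v0.
have [n /asboolP[v <-] nmin] := ex_minnP ex.
by exists v => u; apply: nmin; apply/asboolP; exists u.
Qed.

(** The ball of radius r and the sphere of radius r + 1 both have at most 2k K^(r+1) elements, and
    doubling costs no more than a factor K. *)
Lemma ball_bound x0 r (gs : seq F) :
  (forall v, \sum_i dist x0 (actV phi (a i) x0) <= \sum_i dist v (actV phi (a i) v)) ->
  uniq gs -> (forall g, g \in gs -> dist x0 (actV phi g x0) <= r) ->
  size gs <= 2 * k * K ^ r.+1.
Proof.
move=> x0_min; elim: r gs => [|r IHr] gs ugs hgs.
  apply: leq_trans (growth_bound phi_free phi_noinv hk ha x0_min (r := 0) ugs _) _.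
    by move=> g /hgs; rewrite leqn0 => /eqP.
  by rewrite leq_mul2l leq_pexp2l ?orbT //; lia.
rewrite -(count_predC (fun g => dist x0 (actV phi g x0) <= r)) -!size_filter.
have h : size [seq g <- gs | dist x0 (actV phi g x0) <= r] <= 2 * k * K ^ r.+1.
  by apply: IHr => [|g]; rewrite ?filter_uniq // mem_filter => /andP[].
have h' : size [seq g <- gs | predC (fun g => dist x0 (actV phi g x0) <= r) g] <= 2 * k * K ^ r.+1.
  apply: (growth_bound phi_free phi_noinv hk ha x0_min (r := r.+1)); first exact: filter_uniq.
  by move=> g; rewrite mem_filter /= => /andP[+ /hgs]; lia.
apply: leq_trans (leq_add h h') _; rewrite addnn -mul2n mulnCA leq_mul2l.
by rewrite (expnS _ r.+1) leq_mul2r; lia.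
Qed.

Lemma words_ball_bound x0 r (ws : seq (seq (letter k))) :
  (forall v, \sum_i dist x0 (actV phi (a i) x0) <= \sum_i dist v (actV phi (a i) v)) ->
  uniq ws -> {in ws, forall w, reduced (@linv k) w /\ wlen x0 w <= r} ->
  size ws <= 2 * k * K ^ r.+1.
Proof.
move=> x0_min uws hws; rewrite -(size_map (word_val a)).
apply: (ball_bound x0_min) => [|g /mapP[w /hws[_ wr] ->] //].
rewrite map_inj_in_uniq // => w w' /hws[rw _] /hws[rw' _].
exact: (word_val_inj ha).
Qed.

Lemma wlen_proper x : proper_length (wlen x).
Proof.
have [x0 x0_min] := minimal_basepoint.
apply: (@finite_length_proper _ _ (fun r => 2 * k * K ^ (r + (dist x0 x).*2).+1)).
move=> r ws uws hws; apply: (words_ball_bound x0_min) => // w /hws[rw wr].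
by split=> //; apply: leq_trans (wlen_basepoint hX phi a x0 x w) _; rewrite leq_add2r.
Qed.

(* There are too few elements of small length for the words of length [n] to
   be much shorter than [n] on average. *)
Lemma sum_wlen_ge x0 n :
  (forall v, \sum_i dist x0 (actV phi (a i) x0) <= \sum_i dist v (actV phi (a i) v)) ->
  0 < n ->
  n * size (words k n) <= \sum_(w <- words k n) wlen x0 w + K ^ 2 * size (words k n).
Proof.
move=> x0_min n0.
have small m : count (fun w => wlen x0 w <= m) (words k n) <= 2 * k * K ^ m.+1.
  rewrite -size_filter; apply: (words_ball_bound x0_min); first exact/filter_uniq/words_uniq.
  by move=> w; rewrite mem_filter mem_words => /and3P[].
have geom m : \sum_(0 <= i < m) K ^ i.+1 <= K ^ m.+1.
  elim: m => [|m IHm]; first by rewrite big_geq.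
  rewrite big_nat_recr //= (leq_trans (leq_add IHm (leqnn _))) // addnn -mul2n.
  by rewrite (expnS _ m.+1) leq_mul2r; lia.
(* Layer-cake formula for the truncated difference. *)
have defect w : n - wlen x0 w = \sum_(0 <= m < n) (wlen x0 w <= m).
  elim: (n) => [|m IHm]; first by rewrite big_geq.
  by rewrite big_nat_recr //= -IHm; case: leqP; lia.
(* The layers add up to at most 2k (K + ... + K^n) <= 2k K^(n+1), which is K^2 times the number 2k
   K^(n-1) of words. *)
have : \sum_(w <- words k n) (n - wlen x0 w) <= K ^ 2 * size (words k n).
  under eq_bigr do rewrite defect.
  rewrite exchange_big /=; case: n n0 small defect => // n _ small _.
  apply: (@leq_trans (2 * k * \sum_(0 <= m < n.+1) K ^ m.+1)).
    rewrite big_distrr /=; apply: leq_sum => m _.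
    apply: leq_trans (small m); rewrite -sum1_count [X in _ <= X]big_mkcond /=.
    by apply: leq_sum => w _; case: ifP.
  rewrite size_wordsS mulnCA leq_mul2l -expnD addSn add1n geom orbT //.
have : n * size (words k n) <= \sum_(w <- words k n) (wlen x0 w + (n - wlen x0 w)).
  rewrite -sum1_size big_distrr /=.
  by apply: leq_sum => w _; rewrite muln1; lia.
rewrite big_split /=; lia.
Qed.

End FreeAction.

(** * Computable functions *)

Definition r_add := rPrec (rProj 0) (rComp rSucc [:: rProj 1]).
Definition r_double := rComp r_add [:: rProj 0; rProj 0].
Definition r_isz := rPrec (rComp rSucc [:: rZero]) rZero.
Definition r_odd := rPrec rZero (rComp r_isz [:: rProj 1]).
Definition r_half := rPrec rZero (rComp r_add [:: rProj 1; rComp r_odd [:: rProj 0]]).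
Definition r_iter f := rPrec (rProj 0) (rComp f [:: rProj 1]).
Definition r_cons :=
  rComp (r_iter r_double) [:: rProj 0; rComp rSucc [:: rComp r_double [:: rProj 1]]].
(** The head of a coded list is the 2-adic valuation of the code. [rMu] looks for a zero, hence the
    outer [r_isz]; the second summand stops the search at once on 0, the code of the empty list. *)
Definition r_hd :=
  rMu (rComp r_isz [:: rComp r_add
    [:: rComp r_odd [:: r_iter r_half]; rComp r_isz [:: rProj 1]]]).
Definition r_tl := rComp r_half [:: rComp (r_iter r_half) [:: r_hd; rProj 0]].

(* [CodeSeq.code (a :: s)] is [ncons a (CodeSeq.code s)]. *)
Definition ncons a b := 2 ^ a * b.*2.+1.

Lemma eval_comp1 f g xs y z :
  rec_eval g xs y -> rec_eval f [:: y] z -> rec_eval (rComp f [:: g]) xs z.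
Proof. by move=> gy fz; apply: eval_comp fz; do! constructor. Qed.

Lemma eval_comp2 f g h xs y y' z :
  rec_eval g xs y -> rec_eval h xs y' -> rec_eval f [:: y; y'] z ->
  rec_eval (rComp f [:: g; h]) xs z.
Proof. by move=> gy hy fz; apply: eval_comp fz; do! constructor. Qed.

Lemma eval_proj0 x xs : rec_eval (rProj 0) (x :: xs) x.
Proof. exact: (eval_proj 0 (x :: xs)). Qed.

Lemma eval_proj1 x y xs : rec_eval (rProj 1) [:: x, y & xs] y.
Proof. exact: (eval_proj 1 [:: x, y & xs]). Qed.

Lemma eval_proj2 x y z xs : rec_eval (rProj 2) [:: x, y, z & xs] z.
Proof. exact: (eval_proj 2 [:: x, y, z & xs]). Qed.

Lemma eval_S f xs y : rec_eval f xs y -> rec_eval (rComp rSucc [:: f]) xs y.+1.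
Proof. by move=> fy; apply: eval_comp1 fy _; exact: (eval_succ [:: y]). Qed.

Lemma eval_add x y : rec_eval r_add [:: x; y] (x + y).
Proof.
elim: x => [|x IHx]; first by constructor; exact: eval_proj0.
by apply: eval_precS IHx _; apply: eval_S; exact: eval_proj1.
Qed.

Lemma eval_double x xs : rec_eval r_double (x :: xs) x.*2.
Proof.
rewrite -addnn; apply: eval_comp2; [exact: eval_proj0|exact: eval_proj0|].
exact: eval_add.
Qed.

Lemma eval_isz x : rec_eval r_isz [:: x] (x == 0).
Proof.
elim: x => [|x IHx]; first by constructor; apply/eval_S/eval_zero.
by apply: eval_precS IHx _; constructor.
Qed.

Lemma eval_odd x : rec_eval r_odd [:: x] (odd x).
Proof.
elim: x => [|x IHx]; first by do! constructor.
apply: eval_precS IHx _; apply: eval_comp1; first exact: eval_proj1.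
by rewrite -[X in rec_eval _ _ X]/(nat_of_bool (~~ odd x)) -eqb0; exact: eval_isz.
Qed.

Lemma eval_half x : rec_eval r_half [:: x] x./2.
Proof.
elim: x => [|x IHx]; first by do! constructor.
apply: eval_precS IHx _; rewrite [x.+1./2]uphalf_half addnC.
apply: eval_comp2; [exact: eval_proj1| |exact: eval_add].
by apply: eval_comp1; [exact: eval_proj0|exact: eval_odd].
Qed.

Lemma eval_iter f (F : nat -> nat) n x : (forall x, rec_eval f [:: x] (F x)) ->
  rec_eval (r_iter f) [:: n; x] (iter n F x).
Proof.
move=> fF; elim: n => [|n IHn]; first by constructor; exact: eval_proj0.
by apply: eval_precS IHn _; apply: eval_comp1; [exact: eval_proj1|exact: fF].
Qed.

Lemma iter_double a x : iter a double x = 2 ^ a * x.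
Proof. by elim: a => [|a IHa]; rewrite ?mul1n //= IHa expnS -mul2n mulnA. Qed.

Lemma eval_cons a b : rec_eval r_cons [:: a; b] (ncons a b).
Proof.
rewrite /ncons -iter_double; apply: eval_comp2; first exact: eval_proj0.
  by apply: eval_S; apply: eval_comp1; [exact: eval_proj1|exact: eval_double].
by apply: eval_iter => x; exact: eval_double.
Qed.

Lemma iter_half_ncons a b i : i <= a -> iter i half (ncons a b) = ncons (a - i) b.
Proof.
elim: i => [|i IHi] ia; first by rewrite subn0.
rewrite /= IHi ?(ltnW ia) // /ncons -[a - i](@prednK) ?subn_gt0 //.
by rewrite expnS -mulnA mul2n doubleK; congr (2 ^ _ * _); lia.
Qed.

Lemma odd_ncons a b : odd (ncons a b) = (a == 0).
Proof. by rewrite /ncons oddM oddX /= odd_double orbF andbT. Qed.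

Lemma ncons_gt0 a b : 0 < ncons a b.
Proof. by rewrite muln_gt0 expn_gt0. Qed.

Lemma eval_hd_test n x : rec_eval (rComp r_isz [:: rComp r_add
    [:: rComp r_odd [:: r_iter r_half]; rComp r_isz [:: rProj 1]]]) [:: n; x]
  (odd (iter n half x) + (x == 0) == 0).
Proof.
apply: eval_comp1; last exact: eval_isz.
apply: eval_comp2; last exact: eval_add.
  by apply: eval_comp1; [apply: eval_iter => y; exact: eval_half|exact: eval_odd].
by apply: eval_comp1; [exact: eval_proj1|exact: eval_isz].
Qed.

Lemma eval_hd a b : rec_eval r_hd [:: ncons a b] a.
Proof.
have nz : (ncons a b == 0) = false by rewrite eqn0Ngt ncons_gt0.
apply: (@eval_mu _ _ _ (fun=> 0)) => [|i ia].
  have := eval_hd_test a (ncons a b).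
  by rewrite iter_half_ncons // subnn odd_ncons nz.
have := eval_hd_test i (ncons a b).
rewrite iter_half_ncons ?(ltnW ia) // odd_ncons nz.
by rewrite (_ : (a - i == 0) = false) //; lia.
Qed.

Lemma eval_tl a b : rec_eval r_tl [:: ncons a b] b.
Proof.
rewrite [X in rec_eval _ _ X](_ : b = (iter a half (ncons a b))./2); last first.
  by rewrite iter_half_ncons // subnn /ncons mul1n /= uphalf_double.
apply: eval_comp1; last exact: eval_half.
apply: eval_comp2; [exact: eval_hd|exact: eval_proj0|].
by apply: eval_iter => x; exact: eval_half.
Qed.

Lemma eval_hd0 : rec_eval r_hd [:: 0] 0.
Proof. by apply: (@eval_mu _ _ _ (fun=> 0)) => //; exact: (eval_hd_test 0 0). Qed.

Lemma eval_tl0 : rec_eval r_tl [:: 0] 0.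
Proof.
apply: eval_comp1; last exact: (eval_half 0).
apply: (eval_comp2 (y := 0) (y' := 0)); last first.
- by apply: (@eval_iter _ half 0 0) => x; exact: eval_half.
- exact: eval_proj0.
exact: eval_hd0.
Qed.

Lemma pickle_pair (T U : countType) (x : T) (y : U) :
  pickle (x, y) = ncons (pickle x) (ncons (pickle y) 0).
Proof. by []. Qed.

Lemma pickle_cons (T : countType) (x : T) (s : seq T) :
  pickle (x :: s) = ncons (pickle x) (pickle s).
Proof. by []. Qed.

(** Lets the code of a list serve as the number of rounds of a loop over it. *)
Lemma size_pickle (T : countType) (s : seq T) : size s <= pickle s.
Proof.
elim: s => // x s IHs; rewrite pickle_cons /ncons.
apply: leq_ltn_trans IHs (leq_trans _ (leq_pmull _ _)); last by rewrite expn_gt0.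
by rewrite ltnS -addnn leq_addr.
Qed.

(** Nothing is asked on numbers that are not codes. In the closure lemmas [G] plays the role of a
    context: several variables are passed as nested pairs. *)
Definition computable (T U : countType) (f : T -> U) :=
  exists p, forall x, rec_eval p [:: pickle x] (pickle (f x)).

Section Computable.
Implicit Types G T U V W : countType.

Lemma computable_ext T U (f g : T -> U) : f =1 g -> computable f -> computable g.
Proof. by move=> fg [p hp]; exists p => x; rewrite -fg. Qed.

Lemma computable_id T : computable (@id T).
Proof. by exists (rProj 0) => x; exact: eval_proj0. Qed.

Lemma computable_comp T U V (f : U -> V) (g : T -> U) :
  computable f -> computable g -> computable (fun x => f (g x)).
Proof.
move=> [p hp] [q hq]; exists (rComp p [:: q]) => x.
exact: eval_comp1 (hq x) (hp _).
Qed.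

(** A change of type that keeps codes costs nothing: a boolean read as 0 or 1, an ordinal as a
    number, a value as its own code. *)
Lemma computable_pickle T U V (f : T -> U) (g : T -> V) :
  (forall x, pickle (f x) = pickle (g x)) -> computable f -> computable g.
Proof. by move=> fg [p hp]; exists p => x; rewrite -fg. Qed.

Lemma computable_const G T (x : T) : computable (fun _ : G => x).
Proof.
suff [p hp] : exists p, forall xs, rec_eval p xs (pickle x) by exists p.
elim: (pickle x) => [|n [p hp]]; first by exists rZero => xs; constructor.
by exists (rComp rSucc [:: p]) => xs; apply: eval_S.
Qed.

Lemma computable_ncons G (f g : G -> nat) :
  computable f -> computable g -> computable (fun x => ncons (f x) (g x)).
Proof.
move=> [p hp] [q hq]; exists (rComp r_cons [:: p; q]) => x.
exact: eval_comp2 (hp x) (hq x) (eval_cons _ _).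
Qed.

Lemma computable_cons G T (f : G -> T) (g : G -> seq T) :
  computable f -> computable g -> computable (fun x => f x :: g x).
Proof.
move=> cf cg.
apply: (@computable_pickle _ _ _ (fun x => ncons (pickle (f x)) (pickle (g x)))) => //.
by apply: computable_ncons; [apply: computable_pickle cf|apply: computable_pickle cg].
Qed.

Lemma computable_pair G T U (f : G -> T) (g : G -> U) :
  computable f -> computable g -> computable (fun x => (f x, g x)).
Proof.
move=> cf cg; apply: (@computable_pickle _ _ _
  (fun x => ncons (pickle (f x)) (ncons (pickle (g x)) 0))) => //.
apply: computable_ncons; first by apply: computable_pickle cf.
apply: computable_ncons; [by apply: computable_pickle cg|exact: computable_const].
Qed.

Lemma computable_fst G T U (f : G -> T * U) :
  computable f -> computable (fun x => (f x).1).
Proof.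
apply: computable_comp; exists r_hd => -[x y]; exact: eval_hd.
Qed.

Lemma computable_snd G T U (f : G -> T * U) :
  computable f -> computable (fun x => (f x).2).
Proof.
apply: computable_comp; exists (rComp r_hd [:: r_tl]) => -[x y].
exact: eval_comp1 (eval_tl _ _) (eval_hd _ _).
Qed.

Lemma computable_app2 G T U V (f : T -> U -> V) (g : G -> T) (h : G -> U) :
  computable (fun p : T * U => f p.1 p.2) -> computable g -> computable h ->
  computable (fun x => f (g x) (h x)).
Proof.
by move=> cf cg ch; apply: (@computable_comp _ _ _ _ (fun x => (g x, h x)) cf);
  exact: computable_pair.
Qed.

Lemma computable_app3 G T U V W (f : T -> U -> V -> W) (g : G -> T) (h : G -> U)
    (i : G -> V) :
  computable (fun p : T * (U * V) => f p.1 p.2.1 p.2.2) ->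
  computable g -> computable h -> computable i ->
  computable (fun x => f (g x) (h x) (i x)).
Proof.
move=> cf cg ch ci; apply: (@computable_comp _ _ _ _ (fun x => (g x, (h x, i x))) cf).
by apply: computable_pair => //; exact: computable_pair.
Qed.

Lemma computable_behead G T (f : G -> seq T) :
  computable f -> computable (fun x => behead (f x)).
Proof.
apply: (computable_comp (f := behead)); exists r_tl => -[|x s]; first exact: eval_tl0.
exact: eval_tl.
Qed.

(** Primitive recursion with a parameter; the list operations below are loops of this kind. *)
Lemma computable_iteri G T (n : G -> nat) (st : G -> nat -> T -> T) (b : G -> T) :
  computable n -> computable (fun p : G * (nat * T) => st p.1 p.2.1 p.2.2) ->
  computable b -> computable (fun x => iteri (n x) (st x) (b x)).
Proof.
move=> [pn hn] [ps hs] [pb hb].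
pose r_pair f g := rComp r_cons [:: f; rComp r_cons [:: g; rZero]].
exists (rComp (rPrec pb (rComp ps [:: r_pair (rProj 2) (r_pair (rProj 0) (rProj 1))]))
  [:: pn; rProj 0]) => x.
apply: eval_comp2; [exact: hn|exact: eval_proj0|].
have eval_pair f g xs u v : rec_eval f xs u -> rec_eval g xs v ->
    rec_eval (r_pair f g) xs (ncons u (ncons v 0)).
  move=> fu gv; apply: eval_comp2 fu _ (eval_cons _ _).
  by apply: eval_comp2 gv (eval_zero _) (eval_cons _ _).
rewrite -[pickle (n x)]/(n x); elim: (n x) => [|m IHm]; first by constructor; exact: hb.
apply: eval_precS IHm _ => /=.
apply: eval_comp1 (hs (x, (m, iteri m (st x) (b x)))).
rewrite !pickle_pair; apply: (eval_pair); first exact: eval_proj2.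
by apply: eval_pair; [exact: eval_proj0|exact: eval_proj1].
Qed.

Lemma computable_if G T (c : G -> bool) (f g : G -> T) :
  computable c -> computable f -> computable g ->
  computable (fun x => if c x then f x else g x).
Proof.
move=> cc cf cg; pose n x : nat := c x.
(* A conditional is a loop run at most once. *)
apply: (@computable_ext _ _ (fun x => iteri (n x) (fun _ _ => f x) (g x))).
  by move=> x; rewrite /n; case: (c x).
apply: computable_iteri cg; first by apply: computable_pickle cc.
by apply: computable_comp => //; apply/computable_fst/computable_id.
Qed.

Lemma computable_negb G (c : G -> bool) : computable c -> computable (fun x => ~~ c x).
Proof. by move=> h; apply: computable_if h _ _; apply: computable_const. Qed.

Lemma computable_orb G (c d : G -> bool) :
  computable c -> computable d -> computable (fun x => c x || d x).
Proof. by move=> hc hd; apply: (computable_if hc _ hd); apply: computable_const. Qed.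

Lemma computable_implyb G (c d : G -> bool) :
  computable c -> computable d -> computable (fun x => c x ==> d x).
Proof. by move=> hc hd; apply: (computable_if hc hd); apply: computable_const. Qed.

Lemma computable_addn G (f g : G -> nat) :
  computable f -> computable g -> computable (fun x => f x + g x).
Proof.
move=> [p hp] [q hq]; exists (rComp r_add [:: p; q]) => x.
exact: eval_comp2 (hp x) (hq x) (eval_add _ _).
Qed.

Lemma computable_predn G (f : G -> nat) :
  computable f -> computable (fun x => (f x).-1).
Proof.
move=> cf; apply: (@computable_ext _ _ (fun x => iteri (f x) (fun i _ => i) 0)).
  by move=> x; case: (f x).
apply: computable_iteri cf _ _; last exact: computable_const.
exact/computable_fst/computable_snd/computable_id.
Qed.

Lemma computable_subn G (f g : G -> nat) :
  computable f -> computable g -> computable (fun x => f x - g x).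
Proof.
move=> cf cg; apply: (@computable_ext _ _ (fun x => iteri (g x) (fun _ r => r.-1) (f x))).
  by move=> x; elim: (g x) => [|n IHn]; rewrite ?subn0 //= IHn subnS.
apply: computable_iteri cg _ cf.
exact/computable_predn/computable_snd/computable_snd/computable_id.
Qed.

Lemma computable_muln G (f g : G -> nat) :
  computable f -> computable g -> computable (fun x => f x * g x).
Proof.
move=> cf cg; apply: (@computable_ext _ _ (fun x => iteri (f x) (fun _ r => g x + r) 0)).
  by move=> x; elim: (f x) => //= n ->; rewrite mulSn.
apply: computable_iteri cf _ _; last exact: computable_const.
apply: computable_addn; last exact/computable_snd/computable_snd/computable_id.
by apply: computable_comp cg _; apply/computable_fst/computable_id.
Qed.

Lemma computable_eq0 G (f : G -> nat) : computable f -> computable (fun x => f x == 0).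
Proof.
move=> [p hp]; exists (rComp r_isz [:: p]) => x.
exact: eval_comp1 (hp x) (eval_isz _).
Qed.

Lemma computable_ltn G (f g : G -> nat) :
  computable f -> computable g -> computable (fun x => f x < g x).
Proof.
move=> cf cg; apply: computable_eq0; apply: computable_subn cg.
by apply: (computable_addn (computable_const _ 1) cf).
Qed.

Lemma computable_eq G T (f g : G -> T) :
  computable f -> computable g -> computable (fun x => f x == g x).
Proof.
move=> cf cg; apply: (@computable_ext _ _ (fun x =>
    (pickle (f x) - pickle (g x)) + (pickle (g x) - pickle (f x)) == 0)).
  move=> x; rewrite -(inj_eq (pcan_inj pickleK)); lia.
have cpf : computable (fun x => pickle (f x)) by apply: computable_pickle cf.
have cpg : computable (fun x => pickle (g x)) by apply: computable_pickle cg.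
by apply/computable_eq0/computable_addn; apply: computable_subn.
Qed.

Lemma computable_nilp G T (f : G -> seq T) : computable f -> computable (fun x => nilp (f x)).
Proof.
move=> cf; apply: (computable_ext _ (computable_eq cf (computable_const _ [::]))).
by move=> x; case: (f x).
Qed.

Lemma computable_decode_head G (f : G -> nat) :
  computable f -> computable (fun x => head 0 (CodeSeq.decode (f x))).
Proof.
apply: (computable_comp (f := fun n => head 0 (CodeSeq.decode n))).
exists r_hd => n; rewrite -[in X in rec_eval _ X _](CodeSeq.decodeK n).
by case: (CodeSeq.decode n) => [|a s]; [exact: eval_hd0|exact: eval_hd].
Qed.

Lemma computable_head G T (d : G -> T) (f : G -> seq T) :
  computable d -> computable f -> computable (fun x => head (d x) (f x)).
Proof.
move=> cd cf; apply: (@computable_pickle _ _ _ (fun x =>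
  if nilp (f x) then pickle (d x) else head 0 (CodeSeq.decode (pickle (f x))))).
  move=> x; case: (f x) => //= t s.
  by rewrite (_ : CodeSeq.decode _ = map pickle (t :: s)) //; exact: CodeSeq.codeK.
apply: computable_if; first exact: computable_nilp.
  by apply: computable_pickle cd.
by apply: computable_decode_head; apply: computable_pickle cf.
Qed.

(* [t0] is the junk value of the head of an empty list. *)
Lemma computable_foldl G T U (t0 : T) (st : G -> U -> T -> U) (b : G -> U) (l : G -> seq T) :
  computable (fun p : G * (U * T) => st p.1 p.2.1 p.2.2) ->
  computable b -> computable l -> computable (fun x => foldl (st x) (b x) (l x)).
Proof.
move=> cst cb cl.
(* The state is the rest of the list with the accumulator. The loop runs [pickle (l x)] rounds, and
   rounds after the end of the list change nothing. *)
pose step x (_ : nat) (p : seq T * U) :=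
  if nilp p.1 then p else (behead p.1, st x p.2 (head t0 p.1)).
have stepE x n s z : iteri n (step x) (s, z) = (drop n s, foldl (st x) z (take n s)).
  elim: n => [|n IHn]; first by rewrite drop0 take0.
  rewrite /= IHn /step /=; case: ifP => [|nn].
    by rewrite /nilp size_drop subn_eq0 => sn; rewrite !drop_oversize ?take_oversize // ltnW.
  have sn : n < size s by rewrite -subn_gt0 -size_drop lt0n; apply/negbT.
  rewrite (drop_nth t0 sn) /= (take_nth t0 sn) -cats1 foldl_cat //.
apply: (@computable_ext _ _ (fun x => (iteri (pickle (l x)) (step x) (l x, b x)).2)).
  by move=> x; rewrite stepE /= take_oversize // size_pickle.
apply/computable_snd/computable_iteri; first by apply: computable_pickle cl.
  have cstate := computable_snd (computable_snd (@computable_id (G * (nat * (seq T * U)))%type)).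
  have cp1 := computable_fst cstate.
  apply: computable_if; [exact: computable_nilp cp1|exact: cstate|].
  apply: computable_pair; first exact: computable_behead cp1.
  apply: (computable_app3 cst); [exact/computable_fst/computable_id|exact: computable_snd cstate|].
  by apply: computable_head cp1; exact: computable_const.
exact: computable_pair.
Qed.

Lemma computable_rev G T (t0 : T) (l : G -> seq T) :
  computable l -> computable (fun x => rev (l x)).
Proof.
move=> cl; apply: (@computable_ext _ _ (fun x => foldl (fun s t => t :: s) [::] (l x))).
  move=> x; rewrite /rev; elim: (l x) [::] => //= t s IHs r; exact: IHs.
apply: (computable_foldl t0) => //; last exact: computable_const.
apply: computable_cons; first exact/computable_snd/computable_snd/computable_id.
exact/computable_fst/computable_snd/computable_id.
Qed.

Lemma computable_foldr G T U (t0 : T) (st : G -> T -> U -> U) (b : G -> U) (l : G -> seq T) :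
  computable (fun p : G * (T * U) => st p.1 p.2.1 p.2.2) ->
  computable b -> computable l -> computable (fun x => foldr (st x) (b x) (l x)).
Proof.
move=> cst cb cl.
apply: (@computable_ext _ _ (fun x => foldl (fun u t => st x t u) (b x) (rev (l x)))).
  by move=> x; rewrite foldl_rev.
apply: (computable_foldl t0) => //; last exact: computable_rev.
apply: (computable_app3 cst); [exact/computable_fst/computable_id| |].
  exact/computable_snd/computable_snd/computable_id.
exact/computable_fst/computable_snd/computable_id.
Qed.

Lemma computable_map G T U (t0 : T) (f : G -> T -> U) (l : G -> seq T) :
  computable (fun p : G * T => f p.1 p.2) -> computable l ->
  computable (fun x => map (f x) (l x)).
Proof.
move=> cf cl; apply: (@computable_ext _ _ (fun x => foldr (fun t s => f x t :: s) [::] (l x))).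
  by move=> x; elim: (l x) => //= t s ->.
apply: (computable_foldr t0 (st := fun x t s => f x t :: s)) => //; last exact: computable_const.
apply: computable_cons; last exact/computable_snd/computable_snd/computable_id.
apply: (computable_app2 cf); first exact/computable_fst/computable_id.
exact/computable_fst/computable_snd/computable_id.
Qed.

Lemma computable_filter G T (t0 : T) (f : G -> T -> bool) (l : G -> seq T) :
  computable (fun p : G * T => f p.1 p.2) -> computable l ->
  computable (fun x => [seq t <- l x | f x t]).
Proof.
move=> cf cl; apply: (@computable_ext _ _
    (fun x => foldr (fun t s => if f x t then t :: s else s) [::] (l x))).
  by move=> x; elim: (l x) => //= t s ->.
apply: (computable_foldr t0 (st := fun x t s => if f x t then t :: s else s)) => //;
  last exact: computable_const.
have cs := computable_snd (computable_snd (@computable_id (G * (T * seq T))%type)).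
have ct := computable_fst (computable_snd (@computable_id (G * (T * seq T))%type)).
apply: computable_if (computable_cons ct cs) cs.
by apply: (computable_app2 cf _ ct); exact/computable_fst/computable_id.
Qed.

Lemma computable_cat G T (t0 : T) (f g : G -> seq T) :
  computable f -> computable g -> computable (fun x => f x ++ g x).
Proof.
move=> cf cg; apply: (@computable_ext _ _ (fun x => foldr cons (g x) (f x))).
  by move=> x; elim: (f x) => //= t s ->.
apply: (computable_foldr t0 (st := fun _ => cons)) => //; apply: computable_cons.
  exact/computable_fst/computable_snd/computable_id.
exact/computable_snd/computable_snd/computable_id.
Qed.

Lemma computable_flatten G T (t0 : T) (f : G -> seq (seq T)) :
  computable f -> computable (fun x => flatten (f x)).
Proof.
move=> cf; apply: (computable_foldr [::] (st := fun _ => cat)) => //; last exact: computable_const.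
by apply: (computable_cat t0); [apply: computable_fst|apply: computable_snd];
  exact/computable_snd/computable_id.
Qed.

Lemma computable_all G T (t0 : T) (f : G -> T -> bool) (l : G -> seq T) :
  computable (fun p : G * T => f p.1 p.2) -> computable l ->
  computable (fun x => all (f x) (l x)).
Proof.
move=> cf cl; apply: (@computable_ext _ _ (fun x => nilp [seq t <- l x | ~~ f x t])).
  move=> x; rewrite /nilp size_filter -leqn0 leqNgt -has_count -all_predC.
  by apply: eq_all => t /=; rewrite negbK.
apply: computable_nilp; apply: (computable_filter t0 (f := fun x t => ~~ f x t)) => //.
exact: computable_negb.
Qed.

Lemma computable_sum G T (t0 : T) (f : G -> T -> nat) (l : G -> seq T) :
  computable (fun p : G * T => f p.1 p.2) -> computable l ->
  computable (fun x => \sum_(t <- l x) f x t).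
Proof.
move=> cf cl; apply: (@computable_ext _ _ (fun x => foldr (fun t n => f x t + n) 0 (l x))).
  by move=> x; elim: (l x) => [|t s IHs] /=; rewrite ?big_nil // big_cons IHs.
apply: (computable_foldr t0 (st := fun x t n => f x t + n)) => //; last exact: computable_const.
apply: computable_addn; last exact/computable_snd/computable_snd/computable_id.
apply: (computable_app2 cf); first exact/computable_fst/computable_id.
exact/computable_fst/computable_snd/computable_id.
Qed.

Lemma computable_size G T (t0 : T) (l : G -> seq T) :
  computable l -> computable (fun x => size (l x)).
Proof.
move=> cl; apply: (@computable_ext _ _ (fun x => \sum_(t <- l x) 1)).
  by move=> x; rewrite sum1_size.
by apply: (computable_sum t0 (f := fun _ _ => 1)) => //; exact: computable_const.
Qed.

Lemma computable_nth G T (d : G -> T) (l : G -> seq T) (n : G -> nat) :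
  computable d -> computable l -> computable n ->
  computable (fun x => nth (d x) (l x) (n x)).
Proof.
move=> cd cl cn; apply: (@computable_ext _ _
    (fun x => head (d x) (iteri (n x) (fun _ s => behead s) (l x)))).
  move=> x; rewrite -nth0; have -> m s : iteri m (fun _ s => behead s) s = drop m s.
    by elim: m => [|m IHm]; rewrite ?drop0 //= IHm -drop1 drop_drop add1n.
  by rewrite nth_drop addn0.
apply: computable_head cd _; apply: computable_iteri cn _ cl.
exact/computable_behead/computable_snd/computable_snd/computable_id.
Qed.

(** Stated through [rec_eval] because an unbounded search is a partial function, whereas
    [computable] concerns total ones. *)
Lemma eval_search G (c : nat -> G -> bool) :
  computable (fun p : nat * G => c p.1 p.2) ->
  exists prog, forall x n, c n x -> (forall i, i < n -> ~~ c i x) ->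
    rec_eval prog [:: pickle x] n.
Proof.
move/computable_negb=> [p hp].
pose q := rComp p [:: rComp r_cons [:: rProj 0; rComp r_cons [:: rProj 1; rZero]]].
have hq x n : rec_eval q [:: n; pickle x] (~~ c n x).
  apply: eval_comp1 (hp (n, x)).
  apply: eval_comp2 (eval_proj0 _ _) _ (eval_cons _ _).
  by apply: eval_comp2 (eval_proj1 _ _ _) (eval_zero _) (eval_cons _ _).
exists (rMu q) => x n cn cmin; apply: (@eval_mu _ _ _ (fun=> 0)) => [|i /cmin ci].
  by have := hq x n; rewrite cn.
by have := hq x i; rewrite ci.
Qed.

End Computable.

(** * The program *)

Ltac computable_proj :=
  repeat first [exact: computable_id | exact: computable_const
               | apply: computable_fst | apply: computable_snd].

Lemma computable_reduce (G T : countType) (inv : T -> T) (l : G -> seq T) :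
  T -> computable inv -> computable l -> computable (fun x => reduce inv (l x)).
Proof.
move=> t0 cinv cl.
pose st (_ : G) t r :=
  if nilp r then [:: t] else if head t r == inv t then behead r else t :: r.
apply: (@computable_ext _ _ (fun x => foldr (st x) [::] (l x))).
  by move=> x; rewrite reduceE; elim: (l x) => //= t s ->; case: (foldr _ _ _).
apply: (computable_foldr t0) => //; last exact: computable_const.
rewrite /st; apply: computable_if; first by apply: computable_nilp; computable_proj.
  by apply: computable_cons; computable_proj.
apply: computable_if; last by apply: computable_cons; computable_proj.
  apply: computable_eq; first by apply: computable_head; computable_proj.
  by apply: (computable_comp cinv); computable_proj.
by apply: computable_behead; computable_proj.
Qed.

Lemma computable_winv (G T : countType) (inv : T -> T) (l : G -> seq T) :
  T -> computable inv -> computable l -> computable (fun x => winv inv (l x)).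
Proof.
move=> t0 cinv cl; apply: (computable_rev t0).
apply: (computable_map t0 (f := fun _ => inv)) => //.
by apply: (computable_comp cinv); computable_proj.
Qed.

Section Program.
Variables (k : nat) (l0 : letter k).
Local Notation edge_code := (nat * nat)%type.

Definition einv_code (e : edge_code) : edge_code := (e.1, 1 - e.2).

Definition letter_path (loops : seq (seq edge_code)) (l : letter k) :=
  if l.2 then winv einv_code (nth [::] loops l.1) else nth [::] loops l.1.

Definition loop_length (loops : seq (seq edge_code)) (w : seq (letter k)) :=
  size (reduce einv_code (flatten (map (letter_path loops) w))).

(** The block inequalities over the finitely many triples of words; reducedness is tested as being
    fixed by [reduce], which is computable. *)
Definition block_test (loops : seq (seq edge_code)) n :=
  all (fun u => all (fun v => all (fun w =>
    (reduce (@linv k) (u ++ v ++ w) == u ++ v ++ w) ==>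
    (loop_length loops u + loop_length loops w <
     loop_length loops (u ++ v) + loop_length loops (v ++ w)))
    (words k n)) (words k n)) (words k n).

Definition sum_length loops n := \sum_(w <- words k n) loop_length loops w.

(** (E_(2n) - E_n) / n as an unreduced fraction. The subtraction is truncated, so the value is right
    only when the difference is nonnegative. *)
Definition mean_step_code loops n : nat * nat :=
  (sum_length loops (2 * n) * size (words k n) -
     sum_length loops n * size (words k (2 * n)),
   n * (size (words k n) * size (words k (2 * n)))).

Lemma computable_einv_code : computable einv_code.
Proof.
apply: computable_pair; first by computable_proj.
by apply: computable_subn; computable_proj.
Qed.

Lemma computable_linv : computable (@linv k).
Proof.
apply: (computable_pair (f := fst) (g := fun l => ~~ l.2)); first by computable_proj.
by apply: computable_negb; computable_proj.
Qed.

Lemma computable_letter_path (G : countType) (loops : G -> seq (seq edge_code))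
    (l : G -> letter k) :
  computable loops -> computable l -> computable (fun x => letter_path (loops x) (l x)).
Proof.
move=> cloops cl.
have cnth : computable (fun x => nth [::] (loops x) (l x).1).
  apply: computable_nth => //; first exact: computable_const.
  by apply: (computable_pickle (f := fun x => (l x).1)) => //; exact: computable_fst.
apply: (computable_if _ _ cnth); first exact: computable_snd.
apply: (computable_winv (0, 0)); [exact: computable_einv_code|exact: cnth].
Qed.

Lemma computable_loop_length (G : countType) (loops : G -> seq (seq edge_code))
    (w : G -> seq (letter k)) :
  computable loops -> computable w -> computable (fun x => loop_length (loops x) (w x)).
Proof.
move=> cloops cw; apply: (computable_size (0, 0)).
apply: (computable_reduce (0, 0)); first exact: computable_einv_code.
apply: (computable_flatten (0, 0)).
apply: (computable_map l0 (f := fun x => letter_path (loops x))) => //.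
apply: computable_letter_path; last by computable_proj.
by apply: (computable_comp cloops); computable_proj.
Qed.

Lemma computable_words (G : countType) (n : G -> nat) :
  computable n -> computable (fun x => words k (n x)).
Proof.
move=> cn.
pose st (_ : G) (_ : nat) ws := flatten [seq [seq l :: w | l <- enum {: letter k} &
  nilp w || (head l w != linv l)] | w <- ws].
apply: (@computable_ext _ _ (fun x => iteri (n x) (st x) [:: [::]])).
  move=> x; elim: (n x) => //= m ->; rewrite /st; congr flatten.
  apply: eq_map => w; congr (map _ _); apply: eq_filter => l.
  by case: w.
apply: (computable_iteri cn); last exact: computable_const.
apply: (computable_flatten [::]).
apply: (computable_map [::] (f := fun _ w => [seq l :: w | l <- enum {: letter k} &
  nilp w || (head l w != linv l)])); last by computable_proj.
apply: (computable_map l0 (f := fun p l => l :: p.2)).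
  by apply: computable_cons; computable_proj.
apply: (computable_filter l0 (f := fun p l => nilp p.2 || (head l p.2 != linv l)));
  last exact: computable_const.
apply: computable_orb; first by apply: computable_nilp; computable_proj.
apply/computable_negb/computable_eq; first by apply: computable_head; computable_proj.
by apply: (computable_comp computable_linv); computable_proj.
Qed.

Lemma computable_block_test (G : countType) (loops : G -> seq (seq edge_code)) (n : G -> nat) :
  computable loops -> computable n -> computable (fun x => block_test (loops x) (n x)).
Proof.
move=> cloops cn; have cws := computable_words cn.
have lift (H : countType) (f : H -> G) : computable f ->
    computable (fun x => words k (n (f x))) by move=> cf; exact: (computable_comp cws cf).
apply: (computable_all [::] (f := fun x u => all _ _)) => //.
apply: (computable_all [::] (f := fun p v => all _ _)); last by apply: (lift); computable_proj.
apply: (computable_all [::] (f := fun p w => _ ==> _)); last by apply: (lift); computable_proj.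
have cu := computable_snd (computable_fst (computable_fst (@computable_id
  (G * seq (letter k) * seq (letter k) * seq (letter k))%type))).
have cv := computable_snd (computable_fst (@computable_id
  (G * seq (letter k) * seq (letter k) * seq (letter k))%type)).
have cw := computable_snd (@computable_id
  (G * seq (letter k) * seq (letter k) * seq (letter k))%type).
have cL : computable (fun x : (G * seq (letter k) * seq (letter k) * seq (letter k))%type =>
  loops x.1.1.1) by apply: (computable_comp cloops); computable_proj.
have cuv := computable_cat l0 cu cv; have cvw := computable_cat l0 cv cw.
have cuvw := computable_cat l0 cu cvw.
apply: computable_implyb.
  by apply: computable_eq => //; apply: (computable_reduce l0) => //; exact: computable_linv.
by apply: computable_ltn; apply: computable_addn; apply: computable_loop_length.
Qed.

Lemma computable_sum_length (G : countType) (loops : G -> seq (seq edge_code)) (n : G -> nat) :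
  computable loops -> computable n -> computable (fun x => sum_length (loops x) (n x)).
Proof.
move=> cloops cn.
apply: (computable_sum [::] (f := fun x => loop_length (loops x))); last exact: computable_words.
by apply: computable_loop_length; [apply: (computable_comp cloops)|]; computable_proj.
Qed.

Lemma computable_mean_step_code (G : countType) (loops : G -> seq (seq edge_code)) (n : G -> nat) :
  computable loops -> computable n -> computable (fun x => mean_step_code (loops x) (n x)).
Proof.
move=> cloops cn.
have c2n : computable (fun x => 2 * n x) by apply: computable_muln; [exact: computable_const|].
have csz (m : G -> nat) : computable m -> computable (fun x => size (words k (m x))).
  by move=> cm; apply: (computable_size [::]); exact: computable_words.
apply: computable_pair.
  by apply: computable_subn; apply: computable_muln; rewrite ?computable_sum_length //;
    try exact: csz; exact: computable_sum_length.
by do 2 (apply: computable_muln => //); apply: csz.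
Qed.

(** Search for the least block length that passes, then evaluate there. Successors keep the block
    length positive. *)
Lemma mean_step_program (I : countType) (loops : I -> seq (seq edge_code)) : computable loops ->
  exists prog : recfun, forall x n, block_test (loops x) n.+1 ->
    exists2 m, block_test (loops x) m.+1 &
      rec_eval prog [:: pickle x] (pickle (mean_step_code (loops x) m.+1)).
Proof.
move=> cloops.
have [|p hp] := @eval_search I (fun n x => block_test (loops x) n.+1).
  apply: computable_block_test; first by apply: (computable_comp cloops); computable_proj.
  by apply: (computable_addn (computable_const _ 1)); computable_proj.
have [q hq] : computable (fun y : nat * I => mean_step_code (loops y.2) y.1.+1).
  apply: computable_mean_step_code; first by apply: (computable_comp cloops); computable_proj.
  by apply: (computable_addn (computable_const _ 1)); computable_proj.
exists (rComp q [:: rComp r_cons [:: p; rComp r_cons [:: rProj 0; rZero]]]) => x n hn.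
have ex : exists n, block_test (loops x) n.+1 by exists n.
have [m hm mmin] := ex_minnP ex; exists m => //.
apply: eval_comp1 (hq (m, x)).
apply: eval_comp2 (eval_cons _ _); last first.
  exact: eval_comp2 (eval_proj0 _ _) (eval_zero _) (eval_cons _ _).
apply: hp => // i im; apply/negP => /mmin; rewrite leqNgt; exact/negP/negPn.
Qed.

End Program.

(** * Deck transformations *)

(** As [f] may identify letters, the image of a reduced word may reduce further; cancelling before
    mapping makes no difference. *)
Lemma reduce_map_reduce (T U : eqType) (invT : T -> T) (invU : U -> U) (f : T -> U) s :
  involutive invU -> (forall x, f (invT x) = invU (f x)) ->
  reduce invU (map f (reduce invT s)) = reduce invU (map f s).
Proof.
move=> invUK fV; rewrite (reduceE invT); elim: s => //= e s IHs.
rewrite -[RHS]/(reduce invU ([:: f e] ++ map f s)) -reduce_catr // -IHs reduce_catr //.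
case: (foldr _ _ s) => //= x r; rewrite /push; case: eqP => // -> /=.
rewrite fV -[RHS]/(reduce invU ([:: f e; invU (f e)] ++ map f r)) -reduce_catl //.
by rewrite -[[:: f e; _]]/([:: f e] ++ winv invU [:: f e]) reduce_catV.
Qed.

Section Deck.
Variables (F : groupType) (X G : sgraph) (hX : simplicial_tree X).
Variables (c : covering X G) (x0 : vert X) (p : vert G) (theta : F -> seq (edge G)).
Variable phi : action F X.
Hypothesis theta_iso : pi1_isomorphism p theta.
Hypothesis phi_deck : deck_action c x0 theta phi.
Local Notation red := (reduce (@einv G)).
Local Notation wG := (winv (@einv G)).
Local Notation dist := (dist hX).

(** A backtracking in the image lifts to one in the path, since edges at one vertex with the same
    image coincide. *)
Lemma map_covE_reduced u s v :
  edge_path u s v -> reduced (@einv X) s -> reduced (@einv G) (map (covE c) s).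
Proof.
elim: s u => //= e s IHs u /andP[_ ps]; rewrite !reduced_cons => /andP[es rs].
rewrite (IHs _ ps rs) andbT; case: s ps es {IHs rs} => //= f s /andP[/eqP fo _].
apply: contra => /eqP cfe; apply/eqP.
have ef : orig (covE c f) = covV c (term e) by rewrite cov_orig fo.
have [g [_ g_uniq]] := cov_star ef.
rewrite -(g_uniq f) // -(g_uniq (einv e)) //; split=> //.
by rewrite -cov_einv cfe.
Qed.

Lemma reduce_map_covE u s v : edge_path u s v ->
  red (map (covE c) s) = map (covE c) (reduce (@einv X) s).
Proof.
move=> ps; rewrite -(reduce_map_reduce (invT := @einv X)); first last.
- by move=> e; rewrite cov_einv.
- exact: einvK.
by rewrite reduce_id // (map_covE_reduced (edge_path_reduce ps)) ?reduce_reduced.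
Qed.

Lemma dist_theta g : dist x0 (actV phi g x0) = size (red (theta g)).
Proof.
case: phi_deck => _ _ /(_ g)[s ps <-].
by rewrite (reduce_map_covE ps) size_map /dist -(reduce_geod hX ps).
Qed.

(** The loop is homotopic to its own square, hence trivial. *)
Lemma red_theta1 : red (theta 1%g) = [::].
Proof.
case: theta_iso => _ theta_mul _ _; have := theta_mul 1%g 1%g.
rewrite mulg1 /homotopic => /(reduce_eq_catV (@einvK G)).
set t := theta _; rewrite winv_cat catA => h.
have : red (wG t) = [::].
  rewrite -h -(reduce_catl (@einvK G)) reduce_catV //; exact: einvK.
by rewrite (reduce_winv (@einvK G)) => /(congr1 wG); rewrite winvK //; exact: einvK.
Qed.

Lemma red_thetaV g : red (theta g^-1%g) = red (wG (theta g)).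
Proof.
case: theta_iso => _ theta_mul _ _; have := theta_mul g^-1%g g.
rewrite mulVg /homotopic red_theta1 => /esym h.
by apply/(reduce_eq_catV (@einvK G)); rewrite winvK //; exact: einvK.
Qed.

(** If g fixes [v] and t runs from [x0] to [v], then t followed by the reverse of gt runs from [x0]
    to g [x0]. Its projection cancels completely, so [theta g] is trivial. *)
Lemma deck_free : free_action phi.
Proof.
move=> g v gv; case: (theta_iso) => _ _ theta_inj _; apply: theta_inj.
rewrite /homotopic red_theta1.
case: phi_deck => _ covg /(_ g)[s ps <-].
rewrite (reduce_map_covE ps) (reduce_geod hX ps).
have p1 := geod_path hX x0 v; set t := geod hX x0 v in p1.
have := edge_path_winv (edge_path_act phi g p1); rewrite gv => p2.
move: p2; rewrite -(edge_path_cat _ _ p1) => p2.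
rewrite -(reduce_geod hX p2) -(reduce_map_covE p2) map_cat.
suff -> : map (covE c) (winv (@einv X) (map (actE phi g) t)) = wG (map (covE c) t).
  exact: (reduce_catV (@einvK G)).
rewrite /winv map_rev -!map_comp; congr rev; apply: eq_map => e /=.
by rewrite -cov_einv covg.
Qed.

(** An inverted edge would project to an edge equal to its own reverse. *)
Lemma deck_noinv : without_inversions phi.
Proof.
move=> g e; apply/eqP => ge; case: phi_deck => _ covg _.
by have := einv_neq (covE c e); rewrite cov_einv -ge covg eqxx.
Qed.

Variables (k : nat) (a : 'I_k -> F).

Definition letter_loop (l : letter k) :=
  if l.2 then wG (theta (a l.1)) else theta (a l.1).

Lemma red_theta_word w : red (theta (word_val a w)) = red (flatten (map letter_loop w)).
Proof.
case: theta_iso => _ theta_mul _ _.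
elim: w => [|l w IHw]; first by rewrite word_val_nil red_theta1.
rewrite word_val_cons theta_mul /= -(reduce_catr (@einvK G)) IHw.
rewrite (reduce_catr (@einvK G)) -(reduce_catl (@einvK G)) -[RHS](reduce_catl (@einvK G)).
congr (red (_ ++ _)); case: l => i [] //; exact: red_thetaV.
Qed.

Lemma wlen_loops w : wlen hX phi a x0 w = size (red (flatten (map letter_loop w))).
Proof. by rewrite /wlen dist_theta red_theta_word. Qed.

End Deck.

(** * Numerical codes of edges and loops *)

Section LoopCode.
Variables (n m k : nat) (ends : m.-tuple ('I_n * 'I_n)).
Variable loops : k.-tuple (seq ('I_m * bool)).

Definition edge_code (e : 'I_m * bool) : nat * nat := (nat_of_ord e.1, nat_of_bool e.2).
Definition loops_code := [seq [seq edge_code e | e <- s : seq _] | s <- loops].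

Lemma edge_code_inj : injective edge_code.
Proof. by move=> [i b] [j b'] [/ord_inj -> bb]; congr (_, _); case: b b' bb => [] []. Qed.

Lemma edge_code_inv e : edge_code (fg_inv e) = einv_code (edge_code e).
Proof. by case: e => i []. Qed.

Lemma loop_length_code (theta : 'I_k -> seq (edge (finite_graph ends))) w :
  (forall i, theta i = tnth loops i) ->
  loop_length loops_code w = size (reduce (@einv (finite_graph ends)) (flatten
    [seq (if l.2 then winv (@einv (finite_graph ends)) (theta l.1) else theta l.1) | l <- w])).
Proof.
move=> hth; rewrite /loop_length.
have -> : flatten (map (letter_path loops_code) w) = map edge_code (flatten
    [seq (if l.2 then winv (@fg_inv m) (theta l.1) else theta l.1) | l <- w]).
  rewrite map_flatten -map_comp; congr flatten; apply: eq_map => -[i b] /=.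
  have th : nth [::] loops_code i = map edge_code (theta i).
    rewrite (nth_map [::]) ?size_tuple //; congr map.
    by rewrite hth (tnth_nth [::]).
  rewrite /letter_path /= th; case: b => //=.
  rewrite /winv map_rev -!map_comp; congr rev; apply: eq_map => e /=.
  by rewrite edge_code_inv.
by rewrite (reduce_map _ edge_code_inj edge_code_inv) size_map.
Qed.

End LoopCode.

Lemma block_testP k (loops : seq (seq (nat * nat))) (wl : seq (letter k) -> nat) N :
  (forall w, loop_length loops w = wl w) ->
  reflect (block_condition wl N) (block_test k loops N).
Proof.
move=> hwl; apply: (iffP allP) => [h u v w su sv sw r|h u uN].
  have [ru rvw] := reduced_cat r; have [rv rw] := reduced_cat rvw.
  have mem (t : seq (letter k)) : size t = N -> reduced (@linv k) t -> t \in words k N.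
    by move=> st rt; rewrite mem_words st eqxx.
  have := implyP (allP (allP (h u (mem _ su ru)) v (mem _ sv rv)) w (mem _ sw rw)).
  by rewrite reduce_id // eqxx !hwl; apply.
apply/allP => v vN; apply/allP => w wN; apply/implyP => /eqP r; rewrite !hwl.
move: uN vN wN; rewrite !mem_words => /andP[/eqP su _] /andP[/eqP sv _] /andP[/eqP sw _].
by apply: h => //; rewrite -r reduce_reduced.
Qed.

Local Open Scope classical_set_scope.
Local Open Scope ring_scope.

(** * Averages over reduced words *)

Section Averages.
Variables (R : realType) (k : nat) (hk : (1 < k)%N).
Implicit Types (l : letter k) (u v w : seq (letter k)).
Implicit Types (f g : seq (letter k) -> R).
Local Notation red := (reduced (@linv k)).

(** One step of the Markov chain that prepends a random compatible letter. On reduced [u],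
    [avgn n f u] is the mean of [f] over the reduced words v u with n letters in v: letters are
    revealed from right to left. *)
Definition avg f u : R :=
  (\sum_(l | compatible l u) f (l :: u)) / #|[pred l | compatible l u]|%:R.

Definition avgn n f := iter n avg f.

Definition expect n f : R := (\sum_(w <- words k n) f w) / (size (words k n))%:R.

Lemma card_compatible_gt0 u : 0 < #|[pred l | compatible l u]|%:R :> R.
Proof.
rewrite ltr0n; case: u => [|l u]; last by rewrite count_compatible; lia.
by rewrite (@eq_card _ _ predT) // card_letter; lia.
Qed.

Lemma avg_const (c : R) u : avg (fun=> c) u = c.
Proof.
rewrite /avg sumr_const -[X in X / _]mulr_natr mulfK //.
exact: lt0r_neq0 (card_compatible_gt0 u).
Qed.

Lemma avgD f g u : avg (fun w => f w + g w) u = avg f u + avg g u.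
Proof. by rewrite /avg big_split mulrDl. Qed.

Lemma avgZ (c : R) f u : avg (fun w => c * f w) u = c * avg f u.
Proof. by rewrite /avg -mulr_sumr mulrA. Qed.

Lemma avgB f g u : avg (fun w => f w - g w) u = avg f u - avg g u.
Proof. by rewrite /avg sumrB mulrBl. Qed.

Lemma ler_avg f g u :
  (forall l, compatible l u -> f (l :: u) <= g (l :: u)) -> avg f u <= avg g u.
Proof.
by move=> fg; rewrite ler_pM2r ?invr_gt0 ?card_compatible_gt0 // ler_sum.
Qed.

Lemma eq_avg f g u :
  (forall l, compatible l u -> f (l :: u) = g (l :: u)) -> avg f u = avg g u.
Proof. by move=> fg; apply/eqP; rewrite eq_le !ler_avg // => l /fg ->. Qed.

Lemma avg_dist_le f (c e : R) u :
  (forall l, compatible l u -> `|f (l :: u) - c| <= e) -> `|avg f u - c| <= e.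
Proof.
move=> fe; rewrite -[c in avg f u - c](avg_const c u) -avgB ler_norml.
apply/andP; split.
  by rewrite -[X in X <= _](avg_const _ u); apply: ler_avg => l /fe; rewrite ler_norml => /andP[].
by rewrite -[X in _ <= X](avg_const _ u); apply: ler_avg => l /fe; rewrite ler_norml => /andP[].
Qed.

Lemma expect_avg n f : expect n (avg f) = expect n.+1 f.
Proof.
(* The number of letters that may precede a word of length n. *)
rewrite /expect big_words_S; set c : R := if n is 0 then (2 * k)%:R else (2 * k).-1%:R.
rewrite (eq_big_seq (fun w => (\sum_(l | compatible l w) f (l :: w)) / c)).
  rewrite -mulr_suml -mulrA -invfM mulrC [RHS]mulrC; congr (_^-1 * _).
  rewrite /c; case: n {c} => [|n].
    by rewrite size_wordsS /= expn0 muln1 mulr1.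
  by rewrite !size_wordsS expnS -natrM; congr (_%:R); lia.
move=> w; rewrite mem_words => /andP[/eqP sw _]; rewrite /avg; congr (_ / _).
rewrite /c; case: n w sw {c} => [|n] [|l w] //= _; last by rewrite -(count_compatible l w).
by rewrite (@eq_card _ _ predT) ?card_letter.
Qed.

Lemma avgn_expect n f : avgn n f [::] = expect n f.
Proof.
elim: n f => [|n IHn] f; first by rewrite /expect /= big_seq1 divr1.
by rewrite /avgn iterSr -/(avgn n _) IHn expect_avg.
Qed.

(* Orthogonality of martingale increments, one letter at a time. *)
Lemma variance_avgn f (c : R) :
  (forall m u l l', red (l :: u) -> red (l' :: u) ->
    `|avgn m f (l :: u) - avgn m f (l' :: u)| <= c) ->
  forall m u, red u ->
    avgn m (fun w => f w ^+ 2) u - avgn m f u ^+ 2 <= m%:R * c ^+ 2.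
Proof.
move=> osc; elim=> [|m IHm] u ru; first by rewrite /= mul0r subrr.
rewrite /avgn !iterS -!/(avgn _ _).
set h := avgn m f; set mean := avg h u.
have hc l : red (l :: u) -> `|h (l :: u) - mean| <= c.
  move=> rl; rewrite distrC; apply: avg_dist_le => l' l'u; apply: osc => //.
  by rewrite reduced_consE l'u.
have c0 : 0 <= c.
  have [l lu] : exists l, compatible l u.
    have := card_compatible_gt0 u; rewrite ltr0n => /card_gt0P[l lu].
    by exists l.
  by apply: le_trans (hc l _); rewrite ?normr_ge0 // reduced_consE lu.
(* Law of total variance: the mean of the conditional variances plus the variance of the conditional
   means. *)
have -> : avg (avgn m (fun w => f w ^+ 2)) u - mean ^+ 2
    = avg (fun w => (avgn m (fun w => f w ^+ 2) w - h w ^+ 2)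
        + (h w - mean) ^+ 2) u.
  rewrite avgD avgB.
  have -> : avg (fun w => (h w - mean) ^+ 2) u = avg (fun w => h w ^+ 2) u - mean ^+ 2.
    rewrite (@eq_avg _ (fun w => h w ^+ 2 - 2 * mean * h w + mean ^+ 2)).
      by rewrite avgD avgB avgZ avg_const -/mean; ring.
    by move=> l _; ring.
  by ring.
rewrite -[X in _ <= X](avg_const _ u); apply: ler_avg => l lu.
have rl : red (l :: u) by rewrite reduced_consE lu.
have -> : m.+1%:R * c ^+ 2 = m%:R * c ^+ 2 + c ^+ 2 by rewrite -natr1; ring.
rewrite lerD ?IHm // -real_normK ?num_real // lerXn2r ?nnegrE ?hc //.
Qed.

Lemma sum_words_expect n f :
  \sum_(w <- words k n) f w = (size (words k n))%:R * expect n f.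
Proof.
rewrite /expect mulrCA mulfV ?mulr1 // pnatr_eq0 -lt0n.
by case: n => // n; rewrite size_wordsS muln_gt0 expn_gt0; lia.
Qed.

Lemma chebyshev_words f (c : R) n (t : R) : 0 <= t ->
  (forall m u l l', red (l :: u) -> red (l' :: u) ->
    `|avgn m f (l :: u) - avgn m f (l' :: u)| <= c) ->
  (count (fun w => t <= `|f w - expect n f|) (words k n))%:R * t ^+ 2
    <= n%:R * c ^+ 2 * (size (words k n))%:R.
Proof.
move=> t0 osc.
have := variance_avgn osc n (isT : red [::]); rewrite !avgn_expect => var.
apply: (@le_trans _ _ (\sum_(w <- words k n) (f w - expect n f) ^+ 2)).
  rewrite -sum1_count natr_sum mulr_suml big_mkcond /=; apply: ler_sum => w _.
  case: ifP => [tw|_]; last exact: sqr_ge0.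
  by rewrite mul1r -[X in _ <= X]real_normK ?num_real // lerXn2r ?nnegrE.
have -> : \sum_(w <- words k n) (f w - expect n f) ^+ 2 =
    (size (words k n))%:R * (expect n (fun w => f w ^+ 2) - expect n f ^+ 2).
  rewrite mulrBr -sum_words_expect; set e := expect n f.
  rewrite (eq_bigr (fun w => f w ^+ 2 + (- (2 * e) * f w + e ^+ 2))); last first.
    by move=> w _; ring.
  rewrite !big_split /= -mulr_sumr (sum_words_expect n f) -/e.
  by rewrite big_const_seq count_predT iter_addr_0 -[_ *+ size _]mulr_natl; ring.
by rewrite mulrC ler_wpM2r // ler0n.
Qed.

End Averages.

(** * Oscillation of conditional means, and the block formula for mean lengths *)

Section MeanLength.
Variables (R : realType) (k : nat) (hk : (1 < k)%N).
Variable wl : seq (letter k) -> nat.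
Hypothesis wlP : length_fun wl.
Implicit Types (l : letter k) (u v w : seq (letter k)).
Local Notation red := (reduced (@linv k)).
Local Notation wv := (winv (@linv k)).
Local Notation L := (letter_bound wl).

Definition rlen w : R := (wl w)%:R.

Section Oscillation.
Variable B : nat.
Hypothesis hB : forall s t, red (s ++ t) -> (wl s + wl t <= wl (s ++ t) + B)%N.

(** By bounded cancellation the tail [u] adds |u| to each length, up to B. The word before [u] is
    nonempty so that the same letters may be prepended with or without [u]. *)
Lemma avgn_cat m c v u : red ((c :: v) ++ u) ->
  `|avgn m rlen ((c :: v) ++ u) - avgn m rlen (c :: v) - rlen u| <= B%:R.
Proof.
elim: m c v => [|m IHm] c v r.
  rewrite /avgn /= /rlen -addrA -opprD -natrD.
  have := hB r; have := wl_cat wlP (c :: v) u; rewrite -!(ler_nat R) ler_norml !natrD.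
  by move=> h1 h2; apply/andP; split; lra.
rewrite /avgn !iterS -!/(avgn _ _).
rewrite -[avg _ (_ ++ u)]/(avg (fun w => avgn m rlen (w ++ u)) (c :: v)) -avgB.
apply: avg_dist_le => // l lc; apply: IHm.
by rewrite cat_cons reduced_consE r andbT.
Qed.

(* One more letter divides the oscillation by 2k - 1 and adds a bounded error. *)
Lemma avgn_letter_osc m c c' :
  `|avgn m rlen [:: c] - avgn m rlen [:: c']| <= 3 * (B + L)%:R.
Proof.
elim: m c c' => [|m IHm] c c'.
  rewrite /avgn /= /rlen; have := letter_boundP wl c; have := letter_boundP wl c'.
  rewrite -!(ler_nat R) natrD ler_norml.
  have := ler0n R B; have := ler0n R (wl [:: c]); have := ler0n R (wl [:: c']).
  by move=> *; apply/andP; split; lra.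
pose a (w : seq (letter k)) := if w is l :: _ then avgn m rlen [:: l] else 0.
have near_a d : `|avgn m.+1 rlen [:: d] - avg a [:: d]| <= (B + L)%:R.
  rewrite -[_ - _]subr0 /avgn iterS -/(avgn _ _) -avgB.
  apply: avg_dist_le => // l ld; rewrite subr0.
  have /= := @avgn_cat m l [::] [:: d] _; rewrite reduced_consE ld => /(_ isT).
  have := letter_boundP wl d; rewrite -(ler_nat R) natrD /rlen !ler_norml => h /andP[h1 h2].
  by have := ler0n R (wl [:: d]); move=> h3; apply/andP; split; lra.
(* Only one letter is incompatible with [d], so the averages for two letters differ by a difference
   of two terms divided by K. *)
have avg_a d : avg a [:: d] =
    (\sum_l avgn m rlen [:: l] - avgn m rlen [:: linv d]) / (2 * k).-1%:R.
  rewrite /avg count_compatible [in RHS](bigD1 (linv d)) //= addrAC subrr add0r; congr (_ / _).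
  by apply: eq_bigl => l /=; rewrite eq_sym (inv_eq (@linvK k)).
(* D = 3 (B + L) solves D = 2 (B + L) + D / 3, which is why K >= 3 closes the induction. *)
have K3 : 3%:R <= (2 * k).-1%:R :> R by rewrite ler_nat; lia.
have K0 : 0 < (2 * k).-1%:R :> R by apply: lt_le_trans K3.
have : `|avg a [:: c] - avg a [:: c']| <= (B + L)%:R.
  rewrite !avg_a -mulrBl normrM normfV (gtr0_norm K0) ler_pdivrMr //.
  rewrite [X in `|X|](_ : _ = avgn m rlen [:: linv c'] - avgn m rlen [:: linv c]); last by ring.
  apply: le_trans (IHm _ _) _; rewrite mulrC ler_wpM2l //.
have := near_a c; have := near_a c'; rewrite !ler_norml.
by move=> /andP[? ?] /andP[? ?] /andP[? ?]; apply/andP; split; lra.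
Qed.

Lemma avgn_osc m u l l' : red (l :: u) -> red (l' :: u) ->
  `|avgn m rlen (l :: u) - avgn m rlen (l' :: u)| <= (2 * B + 3 * (B + L))%:R.
Proof.
move=> /(@avgn_cat m l [::] u) + /(@avgn_cat m l' [::] u).
have := avgn_letter_osc m l l'; rewrite natrD !ler_norml /=.
by move=> /andP[? ?] /andP[? ?] /andP[? ?]; apply/andP; split; lra.
Qed.

End Oscillation.

Lemma rlen_deviation : proper_length wl -> exists c : R, forall n (t : R), 0 <= t ->
  (count (fun w => t <= `|rlen w - expect n rlen|) (words k n))%:R * t ^+ 2
    <= n%:R * c * (size (words k n))%:R.
Proof.
move=> wl_proper; have [B hB] := bounded_cancellation wlP wl_proper.
exists ((2 * B + 3 * (B + L))%:R ^+ 2) => n t t0.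
by apply: chebyshev_words => // m u l l'; apply: (avgn_osc hB).
Qed.

Lemma size_words_gt0 n : (0 < size (words k n))%N.
Proof. by case: n => // n; rewrite size_wordsS muln_gt0 expn_gt0; lia. Qed.

Lemma eq_expect n (f g : seq (letter k) -> R) :
  {in words k n, f =1 g} -> expect n f = expect n g.
Proof. by move=> fg; rewrite /expect (eq_big_seq _ fg). Qed.

Lemma expectD n (f g : seq (letter k) -> R) :
  expect n (fun w => f w + g w) = expect n f + expect n g.
Proof. by rewrite /expect big_split mulrDl. Qed.

Lemma expect_drop p m (f : seq (letter k) -> R) : (0 < m)%N ->
  expect (p + m) (fun w => f (drop p w)) = expect m f.
Proof.
case: m => // m _; rewrite /expect big_words_drop // addnS !size_wordsS expnD.
rewrite mulnCA natrM invfM mulrACA [X in X * _](_ : _ = 1) ?mul1r //.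
by rewrite mulfV // pnatr_eq0 -lt0n expn_gt0; lia.
Qed.

(** Inversion permutes the words of a given length, preserves [wl] and exchanges prefixes with
    suffixes. *)
Lemma expect_take p m : (0 < m)%N ->
  expect (m + p) (fun w => rlen (take m w)) = expect m rlen.
Proof.
move=> m0; rewrite addnC -[RHS](expect_drop p) // /expect; congr (_ / _).
rewrite (perm_big _ (winv_words k _)) big_map; apply: eq_big_seq => w.
rewrite mem_words => /andP[/eqP sw _]; rewrite /rlen -(wl_winv wlP (drop p w)).
by rewrite winv_drop sw addKn.
Qed.

(** The average of [block_additive] with the first block split off; each factor of a uniform reduced
    word is itself uniform. *)
Lemma expect_block N n : (0 < N)%N -> block_condition wl N ->
  expect (n.+2 * N) rlen =
  expect (n.+1 * N) rlen + (expect (2 * N) rlen - expect N rlen).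
Proof.
move=> N0 hN.
have e1 : expect (n.+2 * N) (fun w => rlen (take N (drop N w))) = expect N rlen.
  rewrite mulSn (@expect_drop N (n.+1 * N) (fun w => rlen (take N w))) ?muln_gt0 ?N0 //.
  by rewrite mulSn expect_take.
have e2 : expect (n.+2 * N) (fun w => rlen (take (2 * N) w)) = expect (2 * N) rlen.
  by rewrite -add2n mulnDl expect_take // muln_gt0.
have e3 : expect (n.+2 * N) (fun w => rlen (drop N w)) = expect (n.+1 * N) rlen.
  by rewrite mulSn expect_drop ?muln_gt0 ?N0.
suff : expect (n.+2 * N) (fun w => rlen w + rlen (take N (drop N w))) =
    expect (n.+2 * N) (fun w => rlen (take (2 * N) w) + rlen (drop N w)).
  by rewrite !expectD e1 e2 e3; lra.
apply: eq_expect => w; rewrite mem_words => /andP[/eqP sw rw].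
have st : size (take N w) = N by rewrite size_takel // sw mulSn leq_addr.
have sd : size (drop N w) = (n.+1 * N)%N by rewrite size_drop sw mulSn addKn.
have := block_additive wlP N0 hN st sd; rewrite cat_take_drop => /(_ rw) h.
rewrite /rlen -!natrD h; congr (wl _ + _)%:R.
by rewrite mul2n -addnn takeD.
Qed.

Definition mean_step N : R := (expect (2 * N) rlen - expect N rlen) / N%:R.

Lemma expect_blocks N n : (0 < N)%N -> block_condition wl N ->
  expect (n.+1 * N) rlen = expect N rlen + (n * N)%:R * mean_step N.
Proof.
move=> N0 hN; have N0R : N%:R != 0 :> R by rewrite pnatr_eq0 -lt0n.
elim: n => [|n IHn]; first by rewrite mul1n mul0n mul0r addr0.
rewrite expect_block // IHn /mean_step !natrM -natr1; field.
exact: N0R.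
Qed.

End MeanLength.

(** * Almost sure convergence *)

(** The exponent 4 balances two demands: at times N j^4 with tolerance N j^3 Chebyshev's bounds are
    summable, while the gap to the next time is again O(N j^3), negligible against n. *)
Lemma quartic_subsequence_cvg (R : realType) (x : nat -> R) (lam b a : R) (N : nat) :
  (0 < N)%N -> (forall n m, `|x (n + m)%N - x n| <= b * m%:R) ->
  (\forall j \near \oo,
    `|x (N * j ^ 4)%N - lam * (N * j ^ 4)%:R| <= a * (N * j ^ 3)%:R) ->
  (fun n => x n / n%:R) @ \oo --> lam.
Proof.
move=> N0 lip [j0 _ near_j0].
have b0 : 0 <= b by have := lip 0%N 1%N; rewrite mulr1; apply: le_trans.
(* 15 = 4 + 6 + 4 + 1, from (j + 1)^4 - j^4 <= 15 j^3. The total error is at most M N j^3. *)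
pose M := 15 * b + `|a| + 15 * `|lam|.
have M0 : 0 <= M by rewrite /M !addr_ge0 ?mulr_ge0.
apply/cvgrPdist_le => e e0.
pose J := maxn (maxn j0 1) (Num.trunc (M / e)).+1.
near=> n.
have nJ : (N * J ^ 4 <= n)%N by near: n; exact: nbhs_infty_ge.
have [j [Jj jn nj]] : exists j, [/\ (J <= j)%N, (N * j ^ 4 <= n)%N & (n < N * j.+1 ^ 4)%N].
  have [|//|i [_ h1 h2]] := @crossing (fun i => (N * (J + i) ^ 4 <= n)%N) n.+1.
  - by rewrite addn0.
  - rewrite -ltnNge (@leq_trans (J + n.+1)) ?leq_addl //.
    rewrite -[X in (X <= _)%N]mul1n leq_mul //.
    by rewrite -[X in (X <= _)%N]expn1 leq_pexp2l // addnS.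
  by exists (J + i)%N; rewrite leq_addr h1 ltnNge -addnS.
have j1 : (1 <= j)%N by apply: leq_trans Jj; rewrite /J !leq_max leqnn orbT.
have jj0 : (j0 <= j)%N by apply: leq_trans Jj; rewrite /J !leq_max leqnn.
have n0 : (0 < n)%N by apply: leq_trans jn; rewrite muln_gt0 N0 expn_gt0 j1.
have gap : (n - N * j ^ 4 <= 15 * (N * j ^ 3))%N.
  have : (j.+1 ^ 4 <= j ^ 4 + 15 * j ^ 3)%N.
    have -> : (j.+1 ^ 4 = j ^ 4 + 4 * j ^ 3 + 6 * j ^ 2 + 4 * j + 1)%N by rewrite -addn1; lia.
    have : (j ^ 2 <= j ^ 3)%N by rewrite leq_pexp2l.
    have : (j ^ 1 <= j ^ 3)%N by rewrite leq_pexp2l.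
    have : (j ^ 0 <= j ^ 3)%N by rewrite leq_pexp2l.
    rewrite expn0 expn1; lia.
  rewrite -(leq_pmul2l N0) mulnDr; lia.
have jR : 0 < j%:R :> R by rewrite ltr0n.
have nR : 0 < n%:R :> R by rewrite ltr0n.
have main : `|x n - lam * n%:R| <= M * (N * j ^ 3)%:R.
  have h1 := near_j0 j jj0.
  have := lip (N * j ^ 4)%N (n - N * j ^ 4)%N; rewrite subnKC // => h2.
  have gapR : (n - N * j ^ 4)%:R <= 15 * (N * j ^ 3)%:R :> R.
    by rewrite -natrM ler_nat.
  have -> : x n - lam * n%:R = (x n - x (N * j ^ 4)%N) +
      (x (N * j ^ 4)%N - lam * (N * j ^ 4)%:R) + - (lam * (n - N * j ^ 4)%:R).
    by rewrite natrB //; ring.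
  apply: le_trans (ler_normD _ _) _; rewrite normrN normrM normr_nat.
  have h3 : `|x n - x (N * j ^ 4)%N| <= b * (15 * (N * j ^ 3)%:R).
    by apply: le_trans h2 _; rewrite ler_wpM2l.
  have h4 : `|lam| * (n - N * j ^ 4)%:R <= `|lam| * (15 * (N * j ^ 3)%:R).
    by rewrite ler_wpM2l.
  have h5 : a * (N * j ^ 3)%:R <= `|a| * (N * j ^ 3)%:R by rewrite ler_wpM2r ?ler_norm.
  have := ler_normD (x n - x (N * j ^ 4)%N) (x (N * j ^ 4)%N - lam * (N * j ^ 4)%:R).
  rewrite /M; lra.
have -> : lam - x n / n%:R = - ((x n - lam * n%:R) / n%:R).
  by field; rewrite lt0r_neq0.
rewrite normrN normrM normfV normr_nat ler_pdivrMr //.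
apply: le_trans main _.
have Mj : M <= e * j%:R.
  rewrite mulrC -ler_pdivrMr //; apply/ltW/(lt_le_trans (truncnS_gt _)).
  by rewrite ler_nat; apply: leq_trans Jj; rewrite leq_max leqnn orbT.
apply: (@le_trans _ _ (e * j%:R * (N * j ^ 3)%:R)); first by rewrite ler_wpM2r.
rewrite -mulrA -natrM; apply: ler_wpM2l; rewrite ?(ltW e0) // ler_nat.
by apply: leq_trans jn; rewrite expnS; lia.
Unshelve. all: by end_near.
Qed.

Lemma sum_inv_square_le (R : realType) n :
  \sum_(0 <= j < n) (j.+1%:R ^- 2 : R) <= 2.
Proof.
(* The subtracted reciprocal makes the induction telescope. *)
suff h m : \sum_(0 <= j < m.+1) (j.+1%:R ^- 2 : R) <= 2 - m.+1%:R^-1.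
  case: n => [|n]; first by rewrite big_geq.
  by apply: le_trans (h n) _; rewrite gerBl invr_ge0.
elim: m => [|m IHm]; first by rewrite big_nat1 expr1n invr1; lra.
rewrite big_nat_recr //=; apply: (le_trans (lerD IHm (lexx _))).
have m0 : 0 < m.+1%:R :> R by rewrite ltr0n.
have m1 : 0 < m.+2%:R :> R by rewrite ltr0n.
have uv : m.+1%:R^-1 - m.+2%:R^-1 = m.+1%:R^-1 * m.+2%:R^-1 :> R.
  have := lt0r_neq0 m0; have := lt0r_neq0 m1; have : m.+2%:R = m.+1%:R + 1 :> R by rewrite natr1.
  move: m.+1%:R m.+2%:R => x y -> y0 x0; field; exact/andP.
have vu : m.+2%:R^-1 <= m.+1%:R^-1 :> R by rewrite lef_pV2 ?posrE ?ler_nat.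
have v0 : 0 <= m.+2%:R^-1 :> R by rewrite invr_ge0.
rewrite -exprVn expr2; have := ler_wpM2r v0 vu; rewrite -uv.
by move: (m.+1%:R^-1) (m.+2%:R^-1) => u v h; lra.
Qed.

Section Boundary.
Variables (R : realType) (k : nat) (hk : (1 < k)%N).
Variable mu : probability (borel_boundary hk) R.
Hypothesis hmu : uniform_measure mu.
Implicit Types (v : seq (letter k)) (P : pred (seq (letter k))).

Lemma initial_segment_words (w : boundary hk) n : initial_segment w n \in words k n.
Proof.
rewrite mem_words size_mkseq eqxx /= /initial_segment /reduced /mkseq sorted_map.
elim: n 0%N => // -[//|n] IHn m; rewrite /= bwordP; exact: (IHn m.+1).
Qed.

Lemma initial_segmentD (w : boundary hk) n m :
  exists2 v, initial_segment w (n + m) = initial_segment w n ++ v & size v = m.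
Proof.
rewrite /initial_segment /mkseq iotaD map_cat.
by eexists; first reflexivity; rewrite size_map size_iota.
Qed.

Lemma measurable_cylinder v : measurable (cylinder hk v : set (borel_boundary hk)).
Proof. by apply: sub_sigma_algebra; exists v. Qed.

Lemma measure_cylinder n v : (0 < n)%N -> v \in words k n ->
  mu (cylinder hk v) = ((size (words k n))%:R^-1)%:E.
Proof.
case: n => // n _; rewrite mem_words => /andP[/eqP sv rv].
rewrite hmu //; last by rewrite -size_eq0 sv.
rewrite sv size_wordsS natrM natrX natrM /=; congr (_ * _ ^+ _)^-1%:E.
by rewrite -subn1 natrB ?natrM //; lia.
Qed.

Definition event n P : set (borel_boundary hk) := [set w | P (initial_segment w n)].

Lemma event_bigU n P :
  event n P = \big[setU/set0]_(v <- [seq v <- words k n | P v]) cylinder hk v.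
Proof.
rewrite -bigcup_seq; apply/seteqP; split=> [w Pw|w [v /= + wv]].
  exists (initial_segment w n); last by rewrite /cylinder /= size_mkseq.
  by rewrite /= mem_filter Pw initial_segment_words.
rewrite mem_filter mem_words /event /= => /and3P[Pv /eqP sv _].
by move: wv; rewrite /cylinder /= sv => ->.
Qed.

Lemma measurable_event n P : measurable (event n P).
Proof. by rewrite event_bigU; apply: bigsetU_measurable => v _; exact: measurable_cylinder. Qed.

(** Union bound over equally likely cylinders. *)
Lemma measure_event_le n P : (0 < n)%N ->
  (mu (event n P) <= ((count P (words k n))%:R / (size (words k n))%:R)%:E)%E.
Proof.
move=> n0; rewrite event_bigU -size_filter.
have : {subset [seq v <- words k n | P v] <= words k n} by move=> v; rewrite mem_filter => /andP[].
elim: [seq v <- words k n | P v] => [|v s IHs] sub.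
  by rewrite big_nil measure0 mul0r.
rewrite big_cons.
have mv := @measurable_cylinder v.
have ms : measurable (\big[setU/set0]_(u <- s) cylinder hk u : set (borel_boundary hk)).
  by apply: bigsetU_measurable => u _; exact: measurable_cylinder.
apply: (le_trans (measureU2 mu mv ms)).
rewrite /= -natr1 mulrDl EFinD addeC mul1r leeD //.
  by rewrite (measure_cylinder n0) // sub // mem_head.
by apply: IHs => u us; apply: sub; rewrite inE us orbT.
Qed.

Lemma borel_cantelli_event (n : nat -> nat) (P : nat -> pred (seq (letter k))) (c : R) :
  (forall j, (0 < n j)%N) ->
  (forall j, (count (P j) (words k (n j)))%:R * j.+1%:R ^+ 2 <= c * (size (words k (n j)))%:R) ->
  {ae mu, forall w, \forall j \near \oo, ~~ P j (initial_segment w (n j))}.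
Proof.
move=> n0 hP.
have c0 : 0 <= c.
  have := hP 0%N; rewrite expr1n mulr1 => h.
  have s0 : 0 < (size (words k (n 0%N)))%:R :> R by rewrite ltr0n size_words_gt0.
  by rewrite -(pmulr_lge0 _ s0); apply: le_trans h.
pose A j := event (n j) (P j).
have muA j : (mu (A j) <= (c * j.+1%:R ^- 2)%:E)%E.
  apply: le_trans (measure_event_le _ (n0 j)) _; rewrite lee_fin.
  rewrite ler_pdivrMr ?ltr0n ?size_words_gt0 //.
  by rewrite mulrAC ler_pdivlMr ?exprn_gt0.
have A0 : mu (lim_sup_set A) = 0%E.
  apply: lim_sup_set_cvg0; first by move=> j; exact: measurable_event.
  apply: (@le_lt_trans _ _ (c * 2)%:E); last exact: ltry.
  apply: lime_le; first by apply: is_cvg_nneseries => *; exact: measure_ge0.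
  near=> m; apply: (@le_trans _ _ (\sum_(0 <= j < m) (c * j.+1%:R ^- 2)%:E)%E).
    by apply: lee_sum => j _; exact: muA.
  rewrite sumEFin lee_fin -mulr_sumr ler_wpM2l //; exact: sum_inv_square_le.
exists (lim_sup_set A); split=> //.
  apply: bigcap_measurable => // m _; apply: bigcup_measurable => j _.
  exact: measurable_event.
move=> w /= hw m _; apply: contrapT => hm; apply: hw; exists m => // j /= mj.
by apply/negP => Pj; apply: hm; exists j.
Unshelve. all: by end_near.
Qed.

(* By Chebyshev, a deviation by N j^3 at n = N j^4 has probability O(1/j^2). *)
Lemma ae_mean_step (wl : seq (letter k) -> nat) N :
  length_fun wl -> proper_length wl -> (0 < N)%N -> block_condition wl N ->
  {ae mu, forall w : borel_boundary hk,
    (fun n => (wl (initial_segment w n))%:R / n%:R) @ \oo --> mean_step R wl N}.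
Proof.
move=> wlP wl_proper N0 hN; have [c hc] := rlen_deviation R hk wlP wl_proper.
pose n j := (N * j.+1 ^ 4)%N.
pose P j v := (N * j.+1 ^ 3)%:R <= `|rlen R wl v - expect (n j) (rlen R wl)|.
have n_gt0 j : (0 < n j)%N by rewrite muln_gt0 N0 expn_gt0.
have N0R : 0 < N%:R :> R by rewrite ltr0n.
have hP j : (count (P j) (words k (n j)))%:R * j.+1%:R ^+ 2
    <= c / N%:R * (size (words k (n j)))%:R.
  have j0 : 0 < j.+1%:R :> R by rewrite ltr0n.
  have d0 : 0 < N%:R ^+ 2 * j.+1%:R ^+ 4 :> R by rewrite mulr_gt0 ?exprn_gt0.
  have := hc (n j) (N * j.+1 ^ 3)%:R (ler0n _ _).
  have e3 : (N * j.+1 ^ 3)%:R = N%:R * j.+1%:R ^+ 3 :> R by rewrite natrM natrX.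
  have e4 : (n j)%:R = N%:R * j.+1%:R ^+ 4 :> R by rewrite natrM natrX.
  rewrite -/(P j) e3 e4 => h; rewrite -(ler_pM2l d0).
  rewrite [X in X <= _](_ : _ = (count (P j) (words k (n j)))%:R
    * (N%:R * j.+1%:R ^+ 3) ^+ 2); last by ring.
  apply: le_trans h _; rewrite le_eqVlt; apply/orP; left; apply/eqP; field.
  exact: lt0r_neq0.
have := borel_cantelli_event n_gt0 hP.
apply: (@filterS _ _ (ae_filter_ringOfSetsType mu)) => w [j0 _ hj].
(* By the block formula the mean at N j^4 differs from lambda N j^4 by the constant E_N - N lambda;
   the 1 covers the random deviation. *)
pose a := 1 + `|expect N (rlen R wl) - N%:R * mean_step R wl N|.
apply: (@quartic_subsequence_cvg _ (fun n => rlen R wl (initial_segment w n))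
  _ (letter_bound wl)%:R a N N0).
  move=> p m; have [v -> sv] := initial_segmentD w p m; rewrite -natrM -sv /rlen.
  have := wl_size wlP v; have := wl_cat wlP (initial_segment w p) v.
  have := wl_cat wlP (initial_segment w p ++ v) (winv (@linv k) v).
  rewrite (wl_winv wlP) -catA (@wl_eq _ _ wlP (_ ++ v ++ _) (initial_segment w p)).
    move=> h1 h2 h3; rewrite ler_norml.
    move: h1 h2 h3; rewrite -!(ler_nat R) !natrD; move=> *; apply/andP; split; lra.
  rewrite -(reduce_catr (@linvK k)) reduce_catV ?cats0 //; exact: linvK.
(* The event of index j concerns the length N (j + 1)^4, hence the shift. *)
exists j0.+1 => // -[//|j] /= jj0.
have := hj j jj0; rewrite /P -ltNge => dev.
have := @expect_blocks R k hk wl wlP N (j.+1 ^ 4).-1 N0 hN.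
rewrite prednK ?expn_gt0 // mulnC -/(n j) => En.
rewrite En in dev; move: dev.
set x := rlen R wl _; set e := expect N _; set lam := mean_step _ _ _ => dev.
have jn : (((j.+1 ^ 4).-1 * N)%:R = (N * j.+1 ^ 4)%:R - N%:R :> R).
  by rewrite -natrB ?leq_pmulr ?expn_gt0 //; congr (_%:R); rewrite -subn1 mulnBl mul1n mulnC.
have e1 : `|e - N%:R * lam| <= `|e - N%:R * lam| * (N * j.+1 ^ 3)%:R.
  by rewrite ler_peMr // ler1n muln_gt0 N0 expn_gt0.
rewrite /a -/e -/lam mulrDl mul1r.
have -> : x - lam * (N * j.+1 ^ 4)%:R =
    (x - (e + ((j.+1 ^ 4).-1 * N)%:R * lam)) + (e - N%:R * lam).
  by rewrite jn; ring.
apply: le_trans (ler_normD _ _) _; apply: lerD => //; exact: ltW.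
Qed.

End Boundary.

(** * The stretching factor *)

Section FreeActionMean.
Variables (R : realType) (F : groupType) (X : sgraph) (hX : simplicial_tree X).
Variable phi : action F X.
Hypothesis phi_free : free_action phi.
Hypothesis phi_noinv : without_inversions phi.
Variables (k : nat) (hk : (1 < k)%N) (a : 'I_k -> F).
Hypothesis ha : free_basis a.
Local Notation dist := (dist hX).
Local Notation wlen := (wlen hX phi a).
Local Notation K := (2 * k).-1.

(** Along multiples of N the mean length is affine with slope lambda, yet it stays above n - K^2 at
    length n; letting n grow excludes lambda < 1. *)
Lemma mean_step_ge1 x0 N :
  (forall v, (\sum_i dist x0 (actV phi (a i) x0) <= \sum_i dist v (actV phi (a i) v))%N) ->
  (0 < N)%N -> block_condition (wlen x0) N -> 1 <= mean_step R (wlen x0) N.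
Proof.
move=> x0_min N0 hN; rewrite leNgt; apply/negP => lt1.
set lam := mean_step _ _ _ in lt1; set e := expect N (rlen R (wlen x0)).
have bound n : n%:R * (N%:R * (1 - lam)) <= e - N%:R + (K ^ 2)%:R.
  have nN0 : (0 < n.+1 * N)%N by rewrite muln_gt0.
  have := sum_wlen_ge phi_free phi_noinv hk ha x0_min nN0; move: (K ^ 2)%N => k2.
  rewrite -(ler_nat R) natrD !natrM natr_sum.
  rewrite -[\sum_(i <- _) _]/(\sum_(i <- words k (n.+1 * N)) rlen R (wlen x0) i).
  rewrite sum_words_expect // expect_blocks //; last exact: wlen_length_fun.
  have s0 : 0 < (size (words k (n.+1 * N)))%:R :> R by rewrite ltr0n size_words_gt0.
  rewrite mulrC [X in _ <= _ + X]mulrC -mulrDr ler_pM2l // -/e -/lam !natrM -natr1.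
  by move=> h; lra.
have d0 : 0 < N%:R * (1 - lam) by rewrite mulr_gt0 ?ltr0n ?subr_gt0.
have := bound (Num.trunc ((e - N%:R + (K ^ 2)%:R) / (N%:R * (1 - lam)))).+1.
by rewrite -ler_pdivlMr // leNgt truncnS_gt.
Qed.

End FreeActionMean.

Section Displacement.
Variables (R : realType) (F : groupType) (X : sgraph) (hX : simplicial_tree X).
Variable phi : action F X.
Hypothesis phi_free : free_action phi.
Local Notation dist := (dist hX).

Lemma dist_orig_term e : (dist (orig e) (term e) <= 1)%N.
Proof. by apply: (@dist_le _ hX _ _ [:: e]); rewrite /= !eqxx. Qed.

(** A point inside an edge is replaced by the origin of the edge. The constant 4 is generous; any
    bound disappears after division by n. *)
Lemma displacement_vertex (x : Defs.point R X) : exists v, forall g,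
  `|displacement phi x g - (dist v (actV phi g v))%:R| <= 4.
Proof.
case: x => [v|e t ht].
  by exists v => g; rewrite /displacement /= (vdist_dist hX) subrr normr0.
exists (orig e) => g; rewrite /displacement /actP /pdist -act_orig.
have t0 : 0 <= t by case/andP: ht.
have t1 : t <= 1 by case/andP: ht.
case: eqP => [eg|_].
  have : actV phi g (orig e) = orig e by rewrite -act_orig -eg.
  by move/phi_free => ->; rewrite actE1 distvv subrr normr0 subr0 normr0.
have dge : 0 <= (dist (orig e) (term e))%:R :> R by [].
(* If g reverses the edge, both quantities lie between 0 and 1. *)
case: eqP => [eg|_].
  have -> : orig (actE phi g e) = term e by rewrite -[actE phi g e]einvK -eg.
  have := dist_orig_term e; rewrite -(ler_nat R) => d1.
  have : `|t - (1 - t)| <= 1 by rewrite ler_norml; apply/andP; split; lra.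
  have := normr_ge0 (t - (1 - t)); move: `|t - _| => A A0 A1.
  by rewrite ler_norml; apply/andP; split; lra.
set f := actE phi g e; rewrite /pvdist !(vdist_dist hX).
set d0 : R := (dist (orig e) (orig f))%:R.
have ef : (dist (orig e) (term f))%:R <= d0 + 1.
  rewrite natr1 ler_nat; apply: leq_trans (dist_triangle hX (orig f) _ _) _.
  by rewrite -addn1 leq_add2l dist_orig_term.
have fe : d0 <= (dist (orig e) (term f))%:R + 1.
  rewrite natr1 ler_nat; apply: leq_trans (dist_triangle hX (term f) _ _) _.
  by rewrite -addn1 leq_add2l distC dist_orig_term.
have step (v : vert X) : (dist (orig e) v)%:R <= (dist (term e) v)%:R + 1 :> R.
  rewrite natr1 ler_nat; apply: leq_trans (dist_triangle hX (term e) _ _) _.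
  by rewrite -add1n leq_add2r dist_orig_term.
have step' (v : vert X) : (dist (term e) v)%:R <= (dist (orig e) v)%:R + 1 :> R.
  rewrite natr1 ler_nat; apply: leq_trans (dist_triangle hX (orig e) _ _) _.
  by rewrite -add1n leq_add2r distC dist_orig_term.
have := step (orig f); have := step (term f); rewrite -/d0 => s1 s2.
have min_dist (p q c : R) : `|p - c| <= 4 -> `|q - c| <= 4 -> `|Num.min p q - c| <= 4.
  by case: (leP p q).
have shift (p q z : R) : `|p - (d0 - z)| <= 4 -> `|q - (d0 - z)| <= 4 ->
    `|Num.min p q + z - d0| <= 4.
  by move=> hp hq; rewrite -addrA -[z - d0]opprB; apply: min_dist.
have := step' (orig f); have := step' (term f); rewrite -/d0 => s3 s4.
move: s1 s2 s3 s4 ef fe; rewrite -?/d0.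
set p : R := (dist (orig e) (term f))%:R.
set q : R := (dist (term e) (orig f))%:R.
set r : R := (dist (term e) (term f))%:R.
move: d0 p q r shift min_dist => d0 p q r shift min_dist s1 s2 s3 s4 ef fe.
apply: min_dist; apply: shift; rewrite ler_norml; apply/andP; split; lra.
Qed.

End Displacement.

Lemma cvg_bounded_diff (R : realType) (x y : nat -> R) (c lam : R) :
  (forall n, `|x n - y n| <= c) ->
  (fun n => y n / n%:R) @ \oo --> lam -> (fun n => x n / n%:R) @ \oo --> lam.
Proof.
move=> xy ylam.
have c0 : 0 <= c by apply: le_trans (xy 0%N).
rewrite [lam](_ : _ = lam + 0); last by rewrite addr0.
rewrite (_ : (fun n => x n / n%:R) =
    (fun n => y n / n%:R) \+ (fun n => (x n - y n) / n%:R)); last first.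
  by apply/funext => n /=; rewrite -mulrDl addrC subrK.
apply: cvgD => //; apply/cvgrPdist_le => e e0; near=> n.
have n0 : 0 < n%:R :> R by rewrite ltr0n; near: n; exact: nbhs_infty_gt.
rewrite sub0r normrN normrM normfV normr_nat ler_pdivrMr //.
apply: le_trans (xy n) _; rewrite mulrC -ler_pdivrMr //.
near: n; exact: nbhs_infty_ger.
Unshelve. all: by end_near.
Qed.

Section Stretching.
Variables (R : realType) (k : nat) (hk : (1 < k)%N).
Variables (F : groupType) (a : 'I_k -> F) (ha : free_basis a).
Variables (mu : probability (borel_boundary hk) R) (hmu : uniform_measure mu).
Variables (X : sgraph) (phi : action F X) (hX : simplicial_tree X).
Hypothesis phi_free : free_action phi.
Hypothesis phi_noinv : without_inversions phi.

Lemma is_stretching_factor_mean_step x0 N :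
  (0 < N)%N -> block_condition (wlen hX phi a x0) N ->
  is_stretching_factor a mu phi (mean_step R (wlen hX phi a x0) N).
Proof.
move=> N0 hN x; have [v xv] := displacement_vertex hX phi_free x.
have := ae_mean_step hmu (wlen_length_fun hX phi a x0)
  (wlen_proper hX phi_free phi_noinv hk ha x0) N0 hN.
apply: (@filterS _ _ (ae_filter_ringOfSetsType mu)) => w.
apply: (@cvg_bounded_diff _ _ _ (4 + ((dist hX v x0).*2)%:R)) => n.
set s := initial_segment w n.
have := wlen_basepoint hX phi a v x0 s; have := wlen_basepoint hX phi a x0 v s.
rewrite -!(ler_nat R) !natrD distC; have := xv (word_val a s); rewrite -/(wlen hX phi a v s).
by rewrite !ler_norml => /andP[? ?] ? ?; apply/andP; split; lra.
Qed.

Lemma is_stretching_factor_unique (lam lam' : R) :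
  is_stretching_factor a mu phi lam -> is_stretching_factor a mu phi lam' -> lam = lam'.
Proof.
have [v] : inhabited (vert X) by case: hX.
move=> /(_ (Vertex v)) h /(_ (Vertex v)) h'.
have mu_pos : (0 < mu [set: borel_boundary hk])%E by rewrite probability_setT.
have PF := ae_properfilter_algebraOfSetsType mu_pos.
have [w [hw hw']] := @filter_ex _ _ PF _ (@filterI _ _ (ae_filter_ringOfSetsType mu) _ _ h h').
exact: (cvg_unique _ hw hw').
Qed.

(** The almost sure limit is unique, so the choice made by [xget] is this value, for every [x0] and
    every admissible [N]. *)
Lemma stretching_factor_mean_step x0 N :
  (0 < N)%N -> block_condition (wlen hX phi a x0) N ->
  stretching_factor a mu phi = mean_step R (wlen hX phi a x0) N.
Proof.
move=> N0 hN; have h := is_stretching_factor_mean_step N0 hN.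
apply: (is_stretching_factor_unique _ h).
exact: (@xgetPex _ 0 [set lam | is_stretching_factor a mu phi lam]
  (ex_intro _ _ h)).
Qed.

Lemma mean_step_fraction (wl : seq (letter k) -> nat) N : (0 < N)%N ->
  mean_step R wl N = ((\sum_(w <- words k (2 * N)) wl w)%:R / (size (words k (2 * N)))%:R
    - (\sum_(w <- words k N) wl w)%:R / (size (words k N))%:R) / N%:R.
Proof. by move=> N0; rewrite /mean_step /expect !natr_sum. Qed.

(** A mean over words of length n + 1 has denominator 2k K^n, so multiplying by 2k leaves an integer
    times z^n; division by K^j contributes z^j. *)
Lemma mean_step_adjoin (wl : seq (letter k) -> nat) j :
  int_adjoin (2 * k%:R - 1)^-1 (2 * k%:R * mean_step R wl ((2 * k).-1 ^ j)).
Proof.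
set K := (2 * k).-1; set N := (K ^ j)%N; set z : R := (2 * k%:R - 1)^-1.
have zE : z = K%:R^-1 by rewrite /z /K -subn1 natrB ?natrM //; lia.
have K0 : (0 < K)%N by rewrite /K; lia.
have N0 : (0 < N)%N by rewrite expn_gt0 K0.
pose S n := \sum_(w <- words k n) wl w.
have term n : 2 * k%:R * ((S n.+1)%:R / (size (words k n.+1))%:R) = (S n.+1)%:R * z ^+ n.
  rewrite size_wordsS !natrM natrX -/K zE exprVn; field.
  by rewrite expf_neq0 ?pnatr_eq0 ?andbT -?lt0n //; lia.
pose P : {poly int} := 'X^j * ((S (2 * N)%N)%:Z *: 'X^((2 * N).-1) - (S N)%:Z *: 'X^(N.-1)).
exists P; rewrite mean_step_fraction // mulrA mulrBr.
have N2 : (0 < 2 * N)%N by rewrite muln_gt0.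
have := term (2 * N).-1; have := term N.-1; rewrite !prednK // => -> ->.
rewrite /P rmorphM rmorphB /= !map_polyZ /= !map_polyXn.
by rewrite !hornerE -!pmulrn mulrC /N natrX -exprVn -zE.
Qed.

Lemma free_action_stretching_factor :
  let lam := stretching_factor a mu phi in
  [/\ is_stretching_factor a mu phi lam, exists q : rat, lam = ratr q,
      1 <= lam & int_adjoin (2 * k%:R - 1)^-1 (2 * k%:R * lam)].
Proof.
have [x0 x0_min] := minimal_basepoint hX phi a.
have [N0 hN0] := block_condition_exists (wlen_length_fun hX phi a x0)
  (wlen_proper hX phi_free phi_noinv hk ha x0).
set N := ((2 * k).-1 ^ N0)%N.
have hN : block_condition (wlen hX phi a x0) N by apply/hN0/ltnW/ltn_expl; lia.
have N_gt0 : (0 < N)%N by rewrite expn_gt0; lia.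
rewrite /= (stretching_factor_mean_step N_gt0 hN); split.
- exact: is_stretching_factor_mean_step.
- rewrite mean_step_fraction //.
  pose E n : rat := (\sum_(w <- words k n) wlen hX phi a x0 w)%:R / (size (words k n))%:R.
  by exists ((E (2 * N)%N - E N) / N%:R); rewrite !(rmorphB, rmorphM, fmorphV, rmorph_nat).
- exact: (mean_step_ge1 _ phi_free phi_noinv hk ha).
- exact: mean_step_adjoin.
Qed.

End Stretching.

(** Nonnegativity of the mean step makes the truncated numerator the true difference. *)
Lemma mean_step_codeE (R : realType) k (hk : (1 < k)%N) (loops : seq (seq (nat * nat)))
    (wl : seq (letter k) -> nat) N :
  (forall w, loop_length loops w = wl w) -> (0 < N)%N -> 0 <= mean_step R wl N ->
  (0 < (mean_step_code k loops N).2)%N /\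
  mean_step R wl N = (mean_step_code k loops N).1%:R / (mean_step_code k loops N).2%:R.
Proof.
move=> hwl N0; set W := fun n => size (words k n).
have W0 n : (0 < W n)%N by exact: size_words_gt0.
have S n : sum_length k loops n = \sum_(w <- words k n) wl w.
  by apply: eq_bigr => w _; rewrite hwl.
rewrite mean_step_fraction // /mean_step_code /= !S -/(W N) -/(W (2 * N)%N).
move: (\sum_(w <- words k N) _)%N (\sum_(w <- words k (2 * N)) _)%N => s1 s2.
move: (W N) (W (2 * N)%N) (W0 N) (W0 (2 * N)%N) => w1 w2 w1_gt0 w2_gt0.
have fracE : (s2%:R / w2%:R - s1%:R / w1%:R) / N%:R =
    (s2%:R * w1%:R - s1%:R * w2%:R) / (N%:R * (w1%:R * w2%:R)) :> R.
  by field; rewrite !pnatr_eq0 -!lt0n w1_gt0 w2_gt0.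
rewrite fracE => pos; split; first by rewrite !muln_gt0 N0 w1_gt0.
have le12 : (s1 * w2 <= s2 * w1)%N.
  move: pos; rewrite pmulr_lge0 ?subr_ge0 ?invr_gt0 ?mulr_gt0 ?ltr0n //.
  by rewrite -!natrM ler_nat.
by rewrite natrB // !natrM.
Qed.

Theorem theorem4 (R : realType) (k : nat) (hk : (1 < k)%N)
  (F : groupType) (a : 'I_k -> F) (ha : free_basis a)
  (mu : probability (borel_boundary hk) R) (hmu : uniform_measure mu) :
  (forall (X : sgraph) (phi : action F X),
      simplicial_tree X -> free_action phi -> without_inversions phi ->
      let lam := stretching_factor a mu phi in
      [/\ is_stretching_factor a mu phi lam,
          exists q : rat, lam = ratr q,
          1 <= lam &
          int_adjoin (2 * k%:R - 1)^-1 (2 * k%:R * lam)])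
  /\
  (exists prog : recfun,
    forall (n m : nat) (ends : m.-tuple ('I_n * 'I_n)) (p : 'I_n)
      (loops : k.-tuple (seq ('I_m * bool)))
      (theta : F -> seq (edge (finite_graph ends))),
      connected_graph (finite_graph ends) ->
      @pi1_isomorphism F (finite_graph ends) p theta ->
      (forall i : 'I_k, theta (a i) = tnth loops i) ->
      forall (X : sgraph) (c : covering X (finite_graph ends)) (x0 : vert X)
        (phi : action F X),
        simplicial_tree X -> covV c x0 = p -> deck_action c x0 theta phi ->
        exists num den : nat,
          [/\ (0 < den)%N,
              rec_eval prog [:: input_code ends p loops] (pickle (num, den)) &
              stretching_factor a mu phi = num%:R / den%:R]).
Proof.
split=> [X phi hX phi_free phi_noinv|].
  exact: free_action_stretching_factor.
(* The type of the tuple pickled by [input_code]; [snd] extracts the coded loops. *)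
pose input := (nat * seq (nat * nat) * nat * seq (seq (nat * nat)))%type.
have [|prog hprog] := @mean_step_program k (Ordinal (ltnW hk), false) input snd.
  exact/computable_snd/computable_id.
exists prog => n m ends p loops theta _ theta_iso hloops X c x0 phi hX _ phi_deck.
have phi_free := deck_free hX theta_iso phi_deck.
have phi_noinv := deck_noinv phi_deck.
have hwl w : loop_length (loops_code loops) w = wlen hX phi a x0 w.
  by rewrite (wlen_loops hX theta_iso phi_deck) (loop_length_code _ hloops).
have [N0 hN0] := block_condition_exists (wlen_length_fun hX phi a x0)
  (wlen_proper hX phi_free phi_noinv hk ha x0).
pose x : input := (n, [seq (nat_of_ord e.1, nat_of_ord e.2) | e <- ends],
  nat_of_ord p, loops_code loops).
have [N /(block_testP _ hwl) hN eval] := hprog x N0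
  (introT (block_testP _ hwl) (hN0 N0.+1 (leqnSn N0))).
have lamE := stretching_factor_mean_step ha hmu phi_free phi_noinv (ltn0Sn N) hN.
(* The bound lambda >= 1 supplies the nonnegativity required by [mean_step_codeE]. *)
have [_ _ lam1 _] := free_action_stretching_factor ha hmu hX phi_free phi_noinv.
rewrite lamE in lam1 *.
have [den0 lam_code] := mean_step_codeE hk hwl (ltn0Sn N) (le_trans ler01 lam1).
exists (mean_step_code k (loops_code loops) N.+1).1.
exists (mean_step_code k (loops_code loops) N.+1).2.
by split; rewrite // -surjective_pairing.
Qed.
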